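(* Consider the i.i.d. two-state model with anonymization only, where $\mathbf Y$ is the anonymized version of $\mathbf X$. If the group (connected component of the association graph) containing user $1$ has size $s$ and $m=cn^{\frac{2}{s}+\alpha}$, where $c>0$ and $\alpha>0$ are constants, then user $1$ has no privacy as $n$ goes to infinity.
   Context: Users and data: there are $n$ users, and $X_u(k)\in\{0,1\}$ is the data sample of user $u$ at time $k$. Parameters $P_1,\dots,P_n$ are drawn independently from a continuous density $f_P$ for which there are $\delta_1,\delta_2>0$ with $\delta_1\le f_P(p)\le\delta_2$ for $p\in(0,1)$ and $f_P(p)=0$ for $p\notin(0,1)$; their realizations are denoted $p_u$. For each user $u$ the sequence $X_u(1),X_u(2),\dots$ is i.i.d. with $X_u(k)\sim \mathrm{Bernoulli}(p_u)$. The data of different users may be dependent. Let $\mathbf X_u=[X_u(1),\dots,X_u(m)]^T$ and $\mathbf X=[\mathbf X_1,\dots,\mathbf X_n]$, where $m=m(n)$ is the number of observations per user. Association graph: $G(V,F)$ with $V=\{1,\dots,n\}$ is the undirected graph in which $(u,u')\in F$ if $I(X_u(k);X_{u'}(k))>0$ and $(u,u')\notin F$ if $I(X_u(k);X_{u'}(k))=0$, where $I$ is mutual information. $G$ is a disjoint union of subgraphs $G=G_1\cup\cdots\cup G_f$, where $G_j(V_j,F_j)$ is a connected graph on $s_j$ vertices (a ''group''). Anonymization: a random permutation $\Pi$ of the set of $n$ users is applied, and the trace observed under pseudonym $\Pi(u)$ is $\mathbf Y_{\Pi(u)}=\mathbf X_u$; $\mathbf Y=[\mathbf Y_1,\dots,\mathbf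 Y_n]$ is what the adversary observes. Adversary: knows the marginal distributions (the values $p_u$), the anonymization mechanism and the association graph $G$, but not the realization of $\Pi$, and not necessarily the joint distributions of the users' data; the adversary has no other side information. No privacy: user $u$ has no privacy if there exists an algorithm for the adversary producing from its observations and knowledge an estimate $\widetilde{X_u(k)}$ of $X_u(k)$ such that, for all $k\in\mathbb N$, $P\big(\widetilde{X_u(k)}\neq X_u(k)\big)\to0$ as $n\to\infty$.
   Formalization: Added assumption: the joint law of a group's data depends only on the parameters of its own members (otherwise another group could imitate user 1's group). The users form one process whose joint law does not change with n, and the association graph is the same for almost all parameters. *)

(* Defs.v *)
(* MathComp-Analysis. *)
From HB Require Import structures.
From mathcomp Require Import all_boot all_order all_algebra all_fingroup.
From mathcomp Require Import all_classical all_reals all_analysis.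

Set Implicit Arguments.
Unset Strict Implicit.
Unset Printing Implicit Defensive.

Import Order.TTheory GRing.Theory Num.Theory.
Import numFieldNormedType.Exports.

Local Open Scope classical_set_scope.
Local Open Scope ring_scope.

(* I(U; V) in nats.  The convention 0 ln 0 = 0 is automatic, since a zero joint
   probability multiplies the logarithm. *)
Definition mutual_information d (T : measurableType d) (R : realType)
    (mu : {measure set T -> \bar R}) (U V : T -> bool) : R :=
  \sum_(a : bool) \sum_(b : bool)
    let joint := fine (mu [set t | U t = a /\ V t = b]) in
    joint * ln (joint / (fine (mu [set t | U t = a]) *
                         fine (mu [set t | V t = b]))).

Definition group (E : rel nat) (n : nat) (u : 'I_n) : {set 'I_n} :=
  [set v | connect (fun v w : 'I_n => E v w) u v]%SET.

Definition open_cube (R : realType) (n : nat) : set (n.-tuple R) :=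
  [set p | forall u : 'I_n, 0 < tnth p u < 1].

(* Users and times are numbered from 0, so that user 1 of the text is user 0.
   A single process of users 0, 1, 2, ... is given, and the system with n users
   is formed by the users u < n: as n grows, the joint distribution of the
   parameters and the data of given users does not change. *)
Record population (R : realType) := Population {
  disp : measure_display ;
  space : measurableType disp ;
  prob : probability space R ;

  density : R -> R ;
  density_continuous : {within `]0, 1[, continuous density} ;
  density_bounds : exists delta1 delta2 : R, [/\ 0 < delta1, 0 < delta2 &
    forall p : R, 0 < p < 1 -> delta1 <= density p <= delta2] ;
  density_out : forall p : R, ~~ (0 < p < 1) -> density p = 0 ;

  param : nat -> {RV prob >-> R} ;
  params := fun (n : nat) (w : space) => [tuple param u w | u < n] ;
  (* The P_u are independent, each with the given density. *)
  param_iid : forall (n : nat) (A : 'I_n -> set R),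
    (forall u, measurable (A u)) ->
    (prob [set w | forall u : 'I_n, A u (param u w)] =
     \prod_(u < n) \int[lebesgue_measure]_(x in A u) (density x)%:E)%E ;

  (* sample u k is X_u(k) and samples n k is the vector (X_u(k))_(u < n). *)
  sample : nat -> nat -> {RV prob >-> bool} ;
  samples := fun (n k : nat) (w : space) => [tuple sample u k w | u < n] ;
  (* law n p is the conditional law of the vector samples n k given
     params n = p; it does not depend on k. *)
  law : forall n : nat, R.-pker (n.-tuple R) ~> (n.-tuple bool) ;
  (* Given params n, the vectors samples n 0, samples n 1, ... are i.i.d. with
     law law n (params n). *)
  sample_iid : forall (n m : nat) (A : set (n.-tuple R))
      (x : 'I_m -> n.-tuple bool), measurable A ->
    (prob [set w | A (params n w) /\ forall k : 'I_m, samples n k w = x k] =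
     \int[prob]_(w in params n @^-1` A)
       \prod_(k < m) law n (params n w) [set x k])%E ;
  law_bernoulli : forall (n : nat) (p : n.-tuple R) (u : 'I_n) (B : set bool),
    open_cube p ->
    law n p [set x | B (tnth x u)] = bernoulli_prob (tnth p u) B ;

  assoc : rel nat ;
  assoc_irreflexive : irreflexive assoc ;
  assoc_symmetric : symmetric assoc ;
  (* The mutual information is that of X_u(k) and X_v(k) for the realized
     values of the parameters. *)
  assocP : forall (n : nat) (u v : 'I_n), u != v ->
    {ae prob, forall w,
      let I := mutual_information (law n (params n w))
                 (fun x => tnth x u) (fun x => tnth x v) in
      (assoc u v -> 0 < I) /\ (~~ assoc u v -> I = 0)} ;
  (* The joint law of the data of a group is determined by the parameters of
     the members of that group; otherwise a user could influence the data of
     users of other groups through its parameter. *)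
  law_group : forall (n : nat) (u : 'I_n) (p q : n.-tuple R)
      (x : n.-tuple bool), open_cube p -> open_cube q ->
    {in group assoc u, forall v, tnth p v = tnth q v} ->
    let agree := [set y | {in group assoc u, forall v, tnth y v = tnth x v}] in
    law n p agree = law n q agree ;

  (* anonymization n is the permutation applied to the n users: it is uniform and
     independent of the parameters and the data. *)
  anonymization : forall n : nat, space -> 'S_n ;
  anonymization_measurable : forall (n : nat) (s : 'S_n),
    measurable [set w | anonymization n w = s] ;
  anonymization_uniform : forall (n m : nat) (s : 'S_n) (A : set (n.-tuple R))
      (x : 'I_m -> n.-tuple bool), measurable A ->
    (prob [set w | anonymization n w = s /\
                   (A (params n w) /\ forall k : 'I_m, samples n k w = x k)] =
     (n`!%:R^-1)%:E *
     prob [set w | A (params n w) /\ forall k : 'I_m, samples n k w = x k])%E ;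

  (* m(n), the number of observations per user among n users. *)
  observations : nat -> nat
}.

Arguments param {R} p _ : rename.
Arguments params {R} p n w : rename.
Arguments sample {R} p _ _ : rename.
Arguments anonymization {R} p n w : rename.

(* The m(n) x n matrix Y, with Y_(Pi u) = X_u. *)
Definition anonymized (R : realType) (M : population R) (n : nat)
    (w : space M) :
    'M[bool]_(observations M n, n) :=
  \matrix_(k, v) sample M ((anonymization M n w)^-1%g v) k w.

(* What the adversary computes from: the numbers n and m, the values p_u, the
   association graph, the observed matrix Y, and the time k at which the data
   of the target user is to be estimated. *)
Definition algorithm (R : realType) :=
  forall n m : nat, n.-tuple R -> rel 'I_n -> 'M[bool]_(m, n) -> nat -> bool.

Definition measurable_algorithm (R : realType) (alg : algorithm R) :=
  forall (n m : nat) (g : rel 'I_n) (Y : 'M[bool]_(m, n)) (k : nat),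
    measurable [set p : n.-tuple R | alg n m p g Y k].

Definition estimate (R : realType) (alg : algorithm R) (M : population R)
    (n k : nat) (w : space M) : bool :=
  alg n (observations M n) (params M n w) (fun u v : 'I_n => assoc M u v)
    (anonymized n w) k.

(* User u has no privacy when all that is known beforehand of the population is
   that it satisfies C.  The algorithm is chosen before the
   population: it cannot use the joint distribution of the data. *)
Definition no_privacy (R : realType) (C : population R -> Prop) (u : nat) :=
  exists2 alg : algorithm R, measurable_algorithm alg &
    forall M : population R, C M -> forall k : nat,
      prob M [set w | estimate alg n k w <> sample M u k w] @[n --> \oo]
        --> 0%E.

Definition group_size (R : realType) (M : population R) (u s : nat) :=
  \forall n \near \oo,
    forall v : 'I_n, v = u :> nat -> #|group (assoc M) v| = s.

(* Main.v *)
(* Let eta = n^-(1/s + alpha/4), and let S be the group of user 0.  The adversary joins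
   two pseudonyms when the empirical covariance of their traces exceeds 3 eta, and looks
   for a permutation phi of the users such that the empirical means at phi(S) are within
   eta of the p_v and the edges at phi(S) are those of the association graph at S.  It then
   reads the trace of phi(0).

   Since m eta^2 is at least of order n^(alpha/2), a Chernoff bound and a union bound over
   pairs of users put all pair frequencies within eta of their expectations, so that no
   unassociated users are joined.  As S is eventually a fixed finite set and eta -> 0, the
   edges of S are found and its parameters are more than 2 eta apart.  Hence the true
   permutation qualifies, and another one that moves 0 must put S on a connected component
   of size s of the joined graph, inside the group of a user u outside S.  The data of that
   group are independent of the parameters of S.  For given data there are at most s^s ways
   to put S on the component of u, and each is compatible with the parameters of S with
   probability at most (2 delta eta)^s; summing over u gives O(n eta^s) = O(n^(-s alpha/4)). *)
Require Import Defs.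
From mathcomp Require Import all_boot all_order all_algebra all_fingroup.
From mathcomp Require Import all_classical all_reals all_analysis.
From mathcomp Require Import measurable_realfun ring lra.
Import Order.TTheory GRing.Theory Num.Theory.
Import numFieldNormedType.Exports.
Local Open Scope classical_set_scope.
Local Open Scope ring_scope.
Set Implicit Arguments.
Unset Strict Implicit.
Unset Printing Implicit Defensive.

(** * Chernoff bounds for frequencies in i.i.d. samples from a finite set *)

(** [expR z <= (1 - z)^-1], and [(1 - z) * (1 + z + 2 * z ^+ 2) = 1 + z ^+ 2 * (1 - 2 * z)] is at
    least 1. *)
Lemma expR_le_quadratic (R : realType) (z : R) :
  z <= 2^-1 -> expR z <= 1 + z + 2 * z ^+ 2.
Proof.
move=> z_le; have z1 : 0 < 1 - z by lra.
have h : expR z <= (1 - z)^-1.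
  rewrite -[z]opprK expRN lef_pV2 ?posrE ?expR_gt0 ?opprK //.
  exact: expR_ge1Dx.
apply: (le_trans h).
rewrite -[leRHS](mulfK (lt0r_neq0 z1)) -[leLHS]mul1r ler_pM2r ?invr_gt0 //.
by rewrite expr2; nra.
Qed.

Section Chernoff.
Variables (R : realType) (T : finType) (w : T -> R).
Hypotheses (w_ge0 : forall t, 0 <= w t) (w_sum1 : \sum_t w t = 1).

(** The quadratic bound applies since [l * f t <= 2^-1]; its linear term averages to 0, and
    [1 + 2 * l ^+ 2 <= expR (2 * l ^+ 2)]. *)
Lemma mgf_le (f : T -> R) (l : R) :
  (forall t, `|f t| <= 1) -> \sum_t w t * f t = 0 -> 0 <= l <= 2^-1 ->
  \sum_t w t * expR (l * f t) <= expR (2 * l ^+ 2).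
Proof.
move=> f1 f0 /andP[l0 l2].
apply: le_trans (expR_ge1Dx _).
have -> : 1 + 2 * l ^+ 2 =
    \sum_t (w t * (1 + 2 * l ^+ 2) + l * (w t * f t)).
  by rewrite big_split /= -mulr_sumr f0 mulr0 addr0 -mulr_suml w_sum1 mul1r.
apply: ler_sum => t _.
rewrite [l * (w t * _)]mulrCA -mulrDr ler_wpM2l //.
have := f1 t; rewrite ler_norml => /andP[fa fb].
apply: le_trans (expR_le_quadratic _) _; first by nra.
have : (l * f t) ^+ 2 <= l ^+ 2.
  by rewrite exprMn ler_piMr ?sqr_ge0 // expr2; nra.
lra.
Qed.

Lemma sum_ffun_prod (m : nat) (F : T -> R) :
  \sum_(x : {ffun 'I_m -> T}) \prod_(k < m) F (x k) = (\sum_t F t) ^+ m.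
Proof.
by rewrite -(bigA_distr_bigA (fun _ t => F t)) prodr_const card_ord.
Qed.

(** Markov's inequality for the exponential moment of the sum, which factors over the [m] draws. *)
Lemma chernoff_centered (m : nat) (f : T -> R) (eta : R) :
  (forall t, `|f t| <= 1) -> \sum_t w t * f t = 0 -> 0 <= eta <= 1 ->
  \sum_(x : {ffun 'I_m -> T} | m%:R * eta < \sum_(k < m) f (x k))
    \prod_(k < m) w (x k) <= expR (- (m%:R * eta ^+ 2 / 8)).
Proof.
(* This [l] minimizes the exponent per draw, [- l * eta + 2 * l ^+ 2], with value [- eta ^+ 2 / 8];
   it is at most 1/2 because [eta <= 1]. *)
move=> f1 f0 /andP[e0 e1]; set l := eta / 4.
have P0 (x : {ffun 'I_m -> T}) : 0 <= \prod_(k < m) w (x k) by exact: prodr_ge0.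
have step : \sum_(x : {ffun 'I_m -> T} | m%:R * eta < \sum_(k < m) f (x k))
    \prod_(k < m) w (x k) <=
    \sum_(x : {ffun 'I_m -> T}) expR (- (l * (m%:R * eta))) *
      \prod_(k < m) (w (x k) * expR (l * f (x k))).
  rewrite [leRHS](bigID (fun x : {ffun 'I_m -> T} => m%:R * eta < \sum_(k < m) f (x k))) /=.
  rewrite -[leLHS]addr0 lerD //; last first.
    apply: sumr_ge0 => x _; rewrite mulr_ge0 ?expR_ge0 // prodr_ge0 // => k _.
    by rewrite mulr_ge0 ?expR_ge0.
  apply: ler_sum => x xe; rewrite big_split /= mulrCA ler_peMr //.
  rewrite -expR_sum -expRD -mulr_sumr -[X in X <= _]expR0 ler_expR addrC subr_ge0.
  by apply: ler_wpM2l; [rewrite /l; lra | exact: ltW].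
apply: (le_trans step); rewrite -mulr_sumr (sum_ffun_prod m (fun t => w t * expR (l * f t))).
have -> : - (m%:R * eta ^+ 2 / 8) = - (l * (m%:R * eta)) + m%:R * (2 * l ^+ 2).
  by rewrite /l; field.
rewrite expRD ler_wpM2l ?expR_ge0 // mulrC expRM_natr.
rewrite lerXn2r ?nnegrE ?expR_ge0 //; last by apply: mgf_le => //; rewrite /l; lra.
by apply: sumr_ge0 => t _; rewrite mulr_ge0 ?expR_ge0.
Qed.

(** The one-sided bound for the centered indicator of [B] and for its opposite, hence the factor
    2. *)
Lemma chernoff_frequency (m : nat) (B : pred T) (eta : R) : 0 <= eta <= 1 ->
  \sum_(x : {ffun 'I_m -> T} |
      m%:R * eta < `|\sum_(k < m) (B (x k))%:R - m%:R * \sum_(t | B t) w t|)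
    \prod_(k < m) w (x k) <= 2 * expR (- (m%:R * eta ^+ 2 / 8)).
Proof.
move=> eta01; set q := \sum_(t | B t) w t.
have q0 : 0 <= q by apply: sumr_ge0.
have q1 : q <= 1.
  by rewrite -w_sum1 [leRHS](bigID B) /= lerDl sumr_ge0.
pose f t : R := (B t)%:R - q.
have f1 t : `|f t| <= 1.
  by rewrite /f ler_norml; case: (B t) => /=; apply/andP; split; lra.
have f0 : \sum_t w t * f t = 0.
  under eq_bigr do rewrite /f mulrBr mulrC.
  rewrite big_split /= sumrN -mulr_suml w_sum1 mul1r /q [X in _ - X]big_mkcond /=.
  apply/eqP; rewrite subr_eq0; apply/eqP/eq_bigr => t _.
  by case: (B t); rewrite ?mul1r ?mul0r.
have sf (x : {ffun 'I_m -> T}) :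
    \sum_(k < m) (B (x k))%:R - m%:R * q = \sum_(k < m) f (x k).
  by rewrite big_split /= sumrN sumr_const card_ord mulr_natl.
have Nf1 t : `|- f t| <= 1 by rewrite normrN.
have Nf0 : \sum_t w t * - f t = 0.
  by under eq_bigr do rewrite mulrN; rewrite sumrN f0 oppr0.
have h1 := chernoff_centered m f1 f0 eta01.
have h2 := chernoff_centered m Nf1 Nf0 eta01.
rewrite mulrDl mul1r; apply: le_trans (lerD h1 h2).
have P0 (x : {ffun 'I_m -> T}) : 0 <= \prod_(k < m) w (x k) by exact: prodr_ge0.
rewrite (big_mkcond (fun x : {ffun 'I_m -> T} => _ < `|_|)) /=.
rewrite (big_mkcond (fun x : {ffun 'I_m -> T} => _ < \sum_(k < m) f _)) /=.
rewrite (big_mkcond (fun x : {ffun 'I_m -> T} => _ < \sum_(k < m) - f _)) /=.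
rewrite -big_split /=; apply: ler_sum => x _.
rewrite sf sumrN lter_normr.
case: (boolP (_ < \sum_(k < m) f _)) => _ /=; last by rewrite add0r.
by rewrite lerDl; case: ifP.
Qed.
End Chernoff.


(** * Mutual information of two bits *)

Section TwoByTwo.
Variables (R : realType) (F : bool -> bool -> R).
Hypotheses (F_ge0 : forall a b, 0 <= F a b).
Hypothesis F_sum1 : \sum_a \sum_b F a b = 1.
Let rowF a := \sum_b F a b.
Let colF b := \sum_a F a b.
Let I := \sum_a \sum_b F a b * ln (F a b / (rowF a * colF b)).

(** For [x > 0] this is [ln t <= t - 1] at [t = y / x], multiplied by [x], with equality only at
    [t = 1]. *)
Lemma kl_term_ge (x y : R) : 0 <= x -> 0 <= y -> (y = 0 -> x = 0) ->
  x - y <= x * ln (x / y) ?= iff (x == y).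
Proof.
move=> x0 y0 yx; have [->|xn0] := eqVneq x 0.
  split; first by rewrite mul0r sub0r oppr_le0.
  by rewrite mul0r sub0r oppr_eq0 eq_sym.
have xp : 0 < x by rewrite lt0r xn0.
have yp : 0 < y.
  by rewrite lt0r y0 andbT; apply: contra_neq xn0.
have lnE : ln (x / y) = - ln (y / x).
  by rewrite -lnV ?posrE ?divr_gt0 // invf_div.
have E : x * ln (x / y) - (x - y) = x * ((y / x - 1) - ln (y / x)).
  by rewrite lnE; field.
have h : ln (y / x) <= y / x - 1.
  have := @le_ln1Dx R (y / x - 1); rewrite [1 + _]addrC subrK; apply.
  by have := divr_gt0 yp xp; lra.
split; first by rewrite -subr_ge0 E mulr_ge0 // subr_ge0.
rewrite eq_sym -subr_eq0 E mulf_eq0 (negbTE xn0) /=.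
apply/idP/eqP => [/eqP e|->]; last by rewrite divff ?lt0r_neq0 // ln1 !subrr.
have [yx1|ne] := eqVneq (y / x) 1; first by rewrite -[y](divfK xn0) yx1 mul1r.
have lnyx : ln (y / x) = y / x - 1 by lra.
have : 1 + ln (y / x) < expR (ln (y / x)).
  by apply: expR_gt1Dx; rewrite lnyx subr_eq0.
by rewrite lnK ?posrE ?divr_gt0 // lnyx addrC subrK ltxx.
Qed.

(* Each term of the mutual information is at least the corresponding F a b - rowF a * colF b,
   with equality only when the latter is 0, and these differences sum to 0. *)
Lemma two_by_two_mutual_information : (I == 0) = (F true true == rowF true * colF true).
Proof.
have row0 a : 0 <= rowF a by rewrite sumr_ge0.
have col0 b : 0 <= colF b by rewrite sumr_ge0.
have tot : rowF true + rowF false = 1 by rewrite -F_sum1 big_bool.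
have tot' : colF true + colF false = 1.
  by rewrite -F_sum1 exchange_big big_bool.
have Frow a b : F a b <= rowF a.
  by rewrite /rowF (bigD1 b) //= lerDl sumr_ge0.
have Fcol a b : F a b <= colF b.
  by rewrite /colF (bigD1 a) //= lerDl sumr_ge0.
have term a b := @kl_term_ge (F a b) (rowF a * colF b) (F_ge0 a b)
  (mulr_ge0 (row0 a) (col0 b)).
have {}term a b : F a b - rowF a * colF b <=
    F a b * ln (F a b / (rowF a * colF b)) ?= iff (F a b == rowF a * colF b).
  apply: term => /eqP; rewrite mulf_eq0 => /orP[] /eqP z.
    by apply/eqP; rewrite eq_le F_ge0 -z Frow.
  by apply/eqP; rewrite eq_le F_ge0 -z Fcol.
have sum0 : \sum_a \sum_b (F a b - rowF a * colF b) = 0.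
  under eq_bigr => a _ do rewrite big_split /= sumrN -mulr_sumr.
  rewrite big_split /= sumrN F_sum1 -mulr_suml !big_bool /= tot tot'.
  by rewrite mulr1 subrr.
(* With fixed margins a two by two table has one degree of freedom, so that factorization of one
   cell entails that of all four. *)
have eqF a b : F true true = rowF true * colF true -> F a b = rowF a * colF b.
  move: tot tot'; rewrite /rowF /colF !big_bool /= => t1 t2 e.
  have : F false false = 1 - F true true - F true false - F false true by lra.
  by case: a; case: b => //= {}e0; nra.
apply/eqP/eqP => [I0|e]; last first.
  rewrite /I big1 // => a _; rewrite big1 // => b _.
  by apply/eqP; rewrite -(eq_sym 0) -[X in X == _](subrr (F a b)) {2}(eqF a b e) (term a b) (eqF a b e).
have lt := @leif_sum R bool predT (fun a => [forall b, F a b == rowF a * colF b])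
  (fun a => \sum_b (F a b - rowF a * colF b))
  (fun a => \sum_b F a b * ln (F a b / (rowF a * colF b))).
have : 0 <= I ?= iff [forall (a | true), [forall b, F a b == rowF a * colF b]].
  rewrite -sum0; apply: lt => a _.
  exact: (@leif_sum R bool predT (fun b => F a b == rowF a * colF b)).
by case=> _; rewrite I0 eqxx => /esym/forallP/(_ true)/forallP/(_ true)/eqP.
Qed.
End TwoByTwo.

(** * Matching users with traces *)

Section Matching.
Variables (R : realType) (m n : nat).
Implicit Types (eta : R) (X Y : 'M[bool]_(m, n)) (g : rel 'I_n) (p : n.-tuple R).

(** On the diagonal this is the empirical mean of a trace. *)
Definition freq X (v w : 'I_n) : R :=
  (\sum_(k < m) (X k v && X k w)%:R) / m%:R.

(** [3 * eta] bounds the error of an empirical covariance when each frequency is off by at most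
    [eta]; see [covariance_close]. *)
Definition edge (eta : R) X : rel 'I_n := fun v w =>
  (v != w) && (3 * eta < `|freq X v w - freq X v v * freq X w w|).

(** [v] ranges over all users, so that no joined pair may leave the image of the group. *)
Definition matches eta g u0 p X (phi : 'S_n) : bool :=
  [forall u, connect g u0 u ==>
     (`|freq X (phi u) (phi u) - tnth p u| <= eta) &&
     [forall v, edge eta X (phi u) (phi v) == g u v]].

(* phi puts the group of u0 inside the group of u, and the traces of the latter
   cannot tell that this is wrong. *)
Definition impostor eta g u0 p X (u : 'I_n) (phi : 'S_n) : bool :=
  (phi u0 == u) &&
  [forall a, connect g u0 a ==>
     [&& connect g u (phi a),
         `|freq X (phi a) (phi a) - tnth p a| <= eta &
         [forall b, connect g u (phi b) ==> (edge eta X (phi a) (phi b) == g a b)]]].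

(** Joined pairs are restricted to the group of [u], which makes this set a function of the data of
    that group alone. *)
Definition component eta g X (u : 'I_n) : {set 'I_n} :=
  [set v | connect (fun a b => [&& edge eta X a b, connect g u a & connect g u b]) u v]%SET.

Lemma freq_perm X (pi : 'S_n) v w :
  freq (\matrix_(k, a) X k (pi a)) v w = freq X (pi v) (pi w).
Proof. by rewrite /freq; congr (_ / _); apply: eq_bigr => k _; rewrite !mxE. Qed.

(** Permuting the traces only translates the set of matching permutations, so that the analysis can
    be made on unpermuted data. *)
Lemma matches_perm eta g u0 p X (pi phi : 'S_n) :
  matches eta g u0 p (\matrix_(k, a) X k (pi a)) phi =
  matches eta g u0 p X (phi * pi)%g.
Proof.
apply: eq_forallb => u; rewrite freq_perm permM; congr (_ ==> (_ && _)).
apply: eq_forallb => v; rewrite /edge !freq_perm !permM.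
by rewrite (inj_eq (@perm_inj _ pi)).
Qed.

(** A match sends edges of the group of [u0] to joined pairs, hence to edges of [g], so the image of
    the group lies within one group. If that is the group of [u0], the gaps between parameters fix
    [u0]; otherwise the match is an impostor. *)
Lemma matches_unique eta g u0 p X : irreflexive g ->
  (forall v w, edge eta X v w -> g v w) ->
  (forall v w, connect g u0 v -> g v w -> edge eta X v w) ->
  (forall v, connect g u0 v -> `|freq X v v - tnth p v| <= eta) ->
  (forall v, connect g u0 v -> v != u0 -> 2 * eta < `|tnth p v - tnth p u0|) ->
  (forall u phi, ~~ connect g u0 u -> ~~ impostor eta g u0 p X u phi) ->
  matches eta g u0 p X 1 /\
  forall phi, matches eta g u0 p X phi -> phi u0 = u0.
Proof.
move=> girr Hf Ht Hp Hgap Himp; split.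
  apply/forallP => u; apply/implyP => Su; rewrite !perm1 Hp //=.
  apply/forallP => v; rewrite perm1; apply/eqP; apply/idP/idP; [exact: Hf|exact: Ht].
move=> phi /forallP M.
have {}M a : connect g u0 a -> `|freq X (phi a) (phi a) - tnth p a| <= eta /\
    forall b, edge eta X (phi a) (phi b) = g a b.
  move=> Sa; have /implyP/(_ Sa)/andP[-> /forallP h] := M a.
  by split=> // b; exact/eqP.
have conn q : forall a, connect g u0 a -> path g a q ->
    connect g (phi a) (phi (last a q)).
  elim: q => [|b q IH] a Sa /=; first by rewrite connect0.
  move=> /andP[gab pq]; apply: (@connect_trans _ _ (phi b)); last first.
    by apply: IH => //; apply: connect_trans Sa (connect1 gab).
  by apply/connect1/Hf; rewrite (M a Sa).2.
have S0 : connect g u0 u0 by exact: connect0.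
have [Su|nSu] := boolP (connect g u0 (phi u0)).
  (* Otherwise the parameters of [u0] and [phi u0] would both be within [eta] of the empirical mean
     at [phi u0]. *)
  apply/eqP; apply: contraT => ne.
  have := Hgap _ Su ne; have := Hp _ Su; have [h _] := M _ S0.
  move: h; set a := freq _ _ _; set b := tnth _ _; set c := tnth _ _.
  rewrite lter_normr !ler_norml => /andP[h1 h2] /andP[h3 h4] /orP[]; lra.
have := Himp _ phi nSu; rewrite /impostor eqxx /= => /negP[].
apply/forallP => a; apply/implyP => Sa.
have [h1 h2] := M a Sa; rewrite h1 /=; apply/andP; split.
  by have /connectP[q pq ->] := Sa; exact: conn.
by apply/forallP => b; rewrite h2 eqxx implybT.
Qed.

(** Paths of [g] from [u0] are carried by [phi] to joined paths, and joined paths from [u] are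
    pulled back by its inverse. The image is thus fixed by the data, which limits the maps to be
    counted. *)
Lemma impostor_image eta g u0 p X u phi : impostor eta g u0 p X u phi ->
  phi @: [set a | connect g u0 a]%SET = component eta g X u.
Proof.
move=> /andP[/eqP phi0 /forallP M].
have {}M a : connect g u0 a -> connect g u (phi a) /\
    forall b, connect g u (phi b) -> edge eta X (phi a) (phi b) = g a b.
  move=> Sa; have /implyP/(_ Sa)/and3P[-> _ /forallP h] := M a.
  by split=> // b ub; apply/eqP; have /implyP := h b; exact.
have conn q : forall a, connect g u0 a -> path g a q ->
    phi (last a q) \in component eta g X u \/ phi a \notin component eta g X u.
  elim: q => [|b q IH] a Sa /=; first by case: (boolP (_ \in _)); [left|right].
  move=> /andP[gab pq]; have [ca|] := boolP (phi a \in _); last by right.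
  left; have Sb : connect g u0 b := connect_trans Sa (connect1 gab).
  case: (IH b Sb pq) => // /negP[]; move: ca; rewrite !inE => ca.
  apply: connect_trans ca (connect1 _).
  have [h1 h2] := M a Sa; have [h3 _] := M b Sb.
  by rewrite h1 h3 h2 //= gab.
have S0 : connect g u0 u0 by exact: connect0.
apply/setP => v; apply/imsetP/idP => [[a]|].
  rewrite inE => /connectP[q pq ->] ->.
  by case: (conn q u0 S0 pq) => //; rewrite phi0 !inE connect0.
rewrite inE => /connectP[q].
have out : forall a, connect g u0 a ->
    path (fun a b => [&& edge eta X a b, connect g u a & connect g u b]) (phi a) q ->
    exists2 b, connect g u0 b & last (phi a) q = phi b.
  elim: q => [|w q IH] a Sa /=; first by exists a.
  move=> /andP[/and3P[e ua uw] pq].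
  rewrite -(permKV phi w) in e uw pq *; apply: IH => //.
  by apply: (connect_trans Sa (connect1 _)); rewrite -(M a Sa).2.
move=> pq ->; case: (out u0 S0) => [|b Sb h]; first by rewrite phi0.
by exists b; rewrite ?inE // -h phi0.
Qed.

End Matching.


(** * Rates *)

Section Rates.
Variable R : realType.

Lemma cvg_powR_natN (b : R) : 0 < b -> n%:R `^ (- b) @[n --> \oo] --> (0 : R).
Proof.
move=> b0; rewrite -cvg_shiftS /=.
have E n : (n.+1%:R : R) `^ (- b) = n.+1%:R^-1 `^ b.
  by rewrite -powR_inv1 // -powRrM mulN1r.
under eq_fun do rewrite E.
have /cvg_at_rightP := powR_cvg0 b0; apply; split.
  by move=> n; rewrite invr_gt0.
exact: cvg_harmonic.
Qed.

Lemma cvg_natr_powR (b x : R) : 0 < b ->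
  \forall n \near \oo, x < n%:R `^ b.
Proof.
move=> b0; pose e := (`|x| + 1)^-1.
have e0 : 0 < e by rewrite invr_gt0 ltr_wpDl.
have := cvg_powR_natN b0 => /cvgr0Pnorm_lt/(_ _ e0) H.
near=> n.
have n0 : (0 < n%:R :> R) by rewrite ltr0n; near: n; exact: nbhs_infty_gt.
have : `|n%:R `^ (- b)| < e by near: n.
rewrite ger0_norm ?powR_ge0 // powRN ltf_pV2 ?posrE ?powR_gt0 // ?ltr_wpDl //.
by apply: le_lt_trans; rewrite (le_trans (ler_norm _)) // lerDl.
Unshelve. all: by end_near. Qed.

(* Beats any power of n in the union bound over pairs of users. *)
Lemma expRN_le_pow (z : R) (r : nat) : 0 < z -> (0 < r)%N ->
  expR (- z) <= (r%:R / z) ^+ r.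
Proof.
move=> z0 r0; have r0' : 0 < r%:R :> R by rewrite ltr0n.
have zE : expR z = expR (z / r%:R) ^+ r.
  by rewrite -expRM_natr divfK // gt_eqF.
rewrite expRN zE -exprVn.
apply: lerXn2r; rewrite ?nnegrE ?invr_ge0 ?expR_ge0 //.
  by rewrite divr_ge0 // ltW.
rewrite -[leRHS]invf_div lef_pV2 ?posrE ?expR_gt0 ?divr_gt0 //.
by apply: le_trans (expR_ge1Dx _); rewrite lerDr.
Qed.

Variables (s : nat) (c alpha : R).
Hypotheses (s_gt0 : (0 < s)%N) (c_gt0 : 0 < c) (alpha_gt0 : 0 < alpha).

(* Squared, it is n^-(2/s + alpha/2), so that m(n) * tolerance^2 still tends to
   infinity; to the power s, it is o(1/n). *)
Definition tolerance (n : nat) : R := n%:R `^ (- (s%:R^-1 + alpha / 4)).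

Let s0 : 0 < s%:R :> R. Proof. by rewrite ltr0n. Qed.
Let expo_gt0 : 0 < s%:R^-1 + alpha / 4 :> R.
Proof. by rewrite addr_gt0 ?invr_gt0 ?divr_gt0. Qed.

Lemma tolerance_cvg : tolerance n @[n --> \oo] --> (0 : R).
Proof. exact: cvg_powR_natN. Qed.

Lemma tolerance_ge0 n : 0 <= tolerance n.
Proof. exact: powR_ge0. Qed.

Lemma tolerance_le1 n : (0 < n)%N -> tolerance n <= 1.
Proof.
move=> n0; rewrite /tolerance powRN invf_le1 ?powR_gt0 ?ltr0n //.
by rewrite -[leLHS](powRr0 n%:R) ler_powR ?ler1n // ltW.
Qed.

(** The power of [n] is [1 - s (1/s + alpha/4) = - s alpha/4]. This controls the impostors summed
    over all users. *)
Lemma tolerance_expn_cvg (K : R) :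
  n%:R * (K * tolerance n ^+ s) @[n --> \oo] --> (0 : R).
Proof.
rewrite -(mulr0 K).
have a0 : 0 < s%:R * (alpha / 4) by rewrite mulr_gt0 ?divr_gt0.
have lim := cvgMl_tmp (a := K) (cvg_powR_natN a0).
apply: (cvg_trans _ (lim _)); apply: near_eq_cvg.
near=> n; have n0 : (0 < n)%N by near: n; exact: nbhs_infty_gt.
apply/esym; rewrite mulrCA; congr (_ * _).
rewrite /tolerance -powR_mulrn ?powR_ge0 // -powRrM.
rewrite -[X in X * _ `^ _]powRr1 // -powRD; last by rewrite pnatr_eq0 -lt0n n0 implybT.
by congr (_ `^ _); field; rewrite gt_eqF.
Unshelve. all: by end_near. Qed.

Variable m : nat -> nat.
Hypothesis m_rate : forall n, `|(m n)%:R - c * n%:R `^ (2 / s%:R + alpha)| < 1.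

Lemma observations_unbounded k : \forall n \near \oo, (k < m n)%N.
Proof.
have a0 : 0 < 2 / s%:R + alpha :> R by rewrite addr_gt0 ?divr_gt0.
near=> n.
have h : (k%:R + 1) / c < n%:R `^ (2 / s%:R + alpha).
  by near: n; exact: cvg_natr_powR.
have := m_rate n; rewrite ltr_norml => /andP[h1 _].
move: h; rewrite ltr_pdivrMr // mulrC => h.
by rewrite -(ltr_nat R); lra.
Unshelve. all: by end_near. Qed.

(** [m n * tolerance n ^+ 2] is at least [c n^(alpha/2) - 1], and the exponential beats the number
    of pairs. *)
Lemma union_bound_cvg :
  2 * n%:R ^+ 2 * expR (- ((m n)%:R * tolerance n ^+ 2 / 8)) @[n --> \oo] --> (0 : R).
Proof.
pose b := alpha / 2; have b0 : 0 < b by rewrite divr_gt0.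
(* With [b * r >= 3], [expRN_le_pow] gives a decay of order [n^-3], which leaves [n^-1] after the
   factor [n^2]. *)
have [r0 hr0] : exists r0 : nat, 3 / b < r0%:R.
  by exists (Num.truncn (3 / b)).+1; exact: truncnS_gt.
pose r := r0.+1.
have hr : 3 <= b * r%:R.
  have : 3 / b < r%:R by apply: (lt_trans hr0); rewrite ltr_nat.
  by rewrite ltr_pdivrMr // mulrC => /ltW.
pose K := 2 * expR (8^-1) * (r%:R * 8 / c) ^+ r.
have key : \forall n \near \oo,
    0 <= 2 * n%:R ^+ 2 * expR (- ((m n)%:R * tolerance n ^+ 2 / 8)) <= K * n%:R `^ (- 1).
  near=> n; have n0 : (0 < n)%N by near: n; exact: nbhs_infty_gt.
  have n0' : 0 < n%:R :> R by rewrite ltr0n.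
  rewrite mulr_ge0 ?expR_ge0 ?mulr_ge0 ?sqr_ge0 //=.
  (* The term 1 absorbs the rounding of [m n], as [tolerance n ^+ 2 <= 1]; it becomes the factor
     [expR (8^-1)] of [K]. *)
  have mt : c * n%:R `^ b - 1 <= (m n)%:R * tolerance n ^+ 2.
    have t2 : tolerance n ^+ 2 = n%:R `^ (- (2 / s%:R + b)).
      rewrite /tolerance -powR_mulrn ?powR_ge0 // -powRrM; congr (_ `^ _).
      by rewrite /b; field; rewrite gt_eqF.
    have t21 : tolerance n ^+ 2 <= 1 by rewrite exprn_ile1 ?tolerance_ge0 ?tolerance_le1.
    have t20 : 0 <= tolerance n ^+ 2 by rewrite sqr_ge0.
    have -> : n%:R `^ b = n%:R `^ (2 / s%:R + alpha) * tolerance n ^+ 2.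
      rewrite t2 -powRD; last by rewrite (gt_eqF n0') implybT.
      by congr (_ `^ _); rewrite /b; field; rewrite gt_eqF.
    have := m_rate n; rewrite ltr_norml => /andP[h1 _].
    set A := n%:R `^ _ in h1 *; set t := tolerance n ^+ 2 in t21 t20 *.
    nra.
  have nb0 : 0 < n%:R `^ b by rewrite powR_gt0.
  have e1 : expR (- ((m n)%:R * tolerance n ^+ 2 / 8)) <=
      expR (8^-1) * (r%:R * 8 / c / n%:R `^ b) ^+ r.
    apply: (@le_trans _ _ (expR (8^-1 + - (c * n%:R `^ b / 8)))).
      by rewrite ler_expR; lra.
    rewrite expRD ler_wpM2l ?expR_ge0 //.
    apply: le_trans (expRN_le_pow _ (isT : (0 < r)%N)) _; first by rewrite divr_gt0 ?mulr_gt0.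
    by rewrite le_eqVlt; apply/orP; left; apply/eqP; congr (_ ^+ _); field; rewrite !gt_eqF.
  apply: (@le_trans _ _ (2 * n%:R ^+ 2 * (expR (8^-1) * (r%:R * 8 / c / n%:R `^ b) ^+ r))).
    by rewrite ler_wpM2l // mulr_ge0 ?sqr_ge0.
  have -> : 2 * n%:R ^+ 2 * (expR (8^-1) * (r%:R * 8 / c / n%:R `^ b) ^+ r) =
     K * (n%:R ^+ 2 * (n%:R `^ b) ^- r).
    by rewrite expr_div_n /K; ring.
  rewrite ler_wpM2l //.
    by rewrite /K !mulr_ge0 ?expR_ge0 // exprn_ge0 // divr_ge0 ?mulr_ge0 ?ltW.
  rewrite -(powR_mulrn 2 (ltW n0')) -(powR_mulrn r (ltW nb0)) -powRrM -powRN.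
  rewrite -powRD; last by rewrite (gt_eqF n0') implybT.
  by rewrite ler_powR ?ler1n //; lra.
apply: (@squeeze_cvgr _ _ _ _ (fun=> 0) (fun n => K * n%:R `^ (- 1))).
- exact: key.
- exact: cvg_cst.
- by rewrite -(mulr0 K); apply: cvgMl_tmp; exact: cvg_powR_natN.
Unshelve. all: by end_near. Qed.

End Rates.


(** * Events and independence *)

Section FiniteMeasurability.
Context d (T : measurableType d) (R : realType).
Variable mu : {measure set T -> \bar R}.

Lemma measurable_exists (I : finType) (F : I -> set T) :
  (forall i, measurable (F i)) -> measurable [set w | exists i, F i w].
Proof.
move=> mF; rewrite [X in measurable X](_ : _ = \bigcup_(i in setT) F i).
  exact: fin_bigcup_measurable.
by apply/seteqP; split=> w [i]; [exists i|exists i].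
Qed.

Lemma measurable_forall (I : finType) (F : I -> set T) :
  (forall i, measurable (F i)) -> measurable [set w | forall i, F i w].
Proof.
move=> mF; rewrite [X in measurable X](_ : _ = ~` [set w | exists i, (~` F i) w]).
  by apply/measurableC/measurable_exists => i; exact: measurableC.
by apply/seteqP; split=> w /= h; [case=> i; apply|move=> i; apply: contrapT => ?; apply: h; exists i].
Qed.

Lemma fsbig_finType (I : finType) (f : I -> \bar R) :
  (\sum_(i \in [set: I]) f i = \sum_i f i)%E.
Proof.
have := bigfs (@GRing.add (\bar R)) (P := xpredT) (f := f) (index_enum_uniq I).
rewrite (_ : [set` xpredT] = setT); last by apply/seteqP; split.
by move=> <- // i _; rewrite mem_index_enum.
Qed.

Lemma measure_exists_le (I : finType) (F : I -> set T) :
  (forall i, measurable (F i)) ->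
  (mu [set w | exists i, F i w] <= \sum_i mu (F i))%E.
Proof.
move=> mF; rewrite -fsbig_finType; apply: content_sub_fsum; [exact: finite_finset|by move=> i _|exact: measurable_exists|].
by move=> w [i Fi]; exists i.
Qed.

(** With [z] the data, this replaces conditioning by a finite sum; [A] may depend on the value of
    [z]. *)
Lemma measure_fin_partition (Z : finType) (z : T -> Z) (A : Z -> set T) :
  (forall y, measurable ([set w | z w = y] `&` A y)) ->
  mu [set w | A (z w) w] = (\sum_y mu ([set w | z w = y] `&` A y))%E.
Proof.
move=> mA; rewrite -fsbig_finType -measure_fin_bigcup; [|exact: finite_finset| |by move=> y _].
  by congr (mu _); apply/seteqP; split=> [w Aw|w [y _ [<-]]] //=; exists (z w).
by move=> y y' _ _ [w [[<- _] [<- _]]].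
Qed.

Lemma measurable_fin_partition (Z : finType) (z : T -> Z) (A : Z -> set T) :
  (forall y, measurable ([set w | z w = y] `&` A y)) ->
  measurable [set w | A (z w) w].
Proof.
move=> mA; rewrite [X in measurable X](_ : _ =
    [set w | exists y, ([set w | z w = y] `&` A y) w]).
  exact: measurable_exists.
by apply/seteqP; split=> [w Aw|w [y [<-]]] //=; exists (z w).
Qed.

End FiniteMeasurability.

Section Independence.
Context d d' (T : measurableType d) (T' : measurableType d') (R : realType).
Variables (P : probability T R) (B : set T) (phi : T -> T') (H : T' -> \bar R).
Hypotheses (mB : measurable B) (mphi : measurable_fun setT phi).
Hypotheses (mH : measurable_fun setT H) (H_ge0 : forall t, (0 <= H t)%E).
Hypothesis indep : forall A, measurable A ->
  P (phi @^-1` A `&` B) = (P (phi @^-1` A) * P B)%E.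

(** The restriction of [P] to [B], pushed forward by [phi], is [P B] times the image of [P] by
    [phi]; [H] is integrated against both. *)
Lemma integral_indep :
  (\int[P]_(w in B) H (phi w) = P B * \int[P]_w H (phi w))%E.
Proof.
have mHphi : measurable_fun setT (H \o phi) by exact: measurableT_comp.
have B01 : (0 <= fine (P B)) by rewrite fine_ge0.
pose k : {nonneg R} := NngNum B01.
have kE : k%:num%:E = P B by rewrite /= fineK // fin_num_measure.
have mB' : measurable (~` B) by exact: measurableC.
transitivity (\int[mrestr P mB]_w (H \o phi) w)%E.
  rewrite [RHS](ge0_negligible_integral (N := ~` B)) //=; last by rewrite /mrestr setICl measure0.
  rewrite setTD setCK; apply: eq_measure_integral => A mA AB.
  by rewrite /= /mrestr setIidl.
rewrite -(ge0_integral_pushforward mphi (mrestr P mB) (f := H) measurableT) //.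
rewrite -kE -[X in (_ * X)%E](ge0_integral_pushforward mphi P (f := H) measurableT) //.
rewrite -ge0_integral_mscale //.
apply: eq_measure_integral => A mA _.
by rewrite /= /pushforward /mrestr /= /mscale /= indep // muleC fineK // fin_num_measure.
Qed.
End Independence.


Section TupleMeasurability.
Context d (T : measurableType d) (n : nat).

Definition rectangle (A : 'I_n -> set T) : set (n.-tuple T) :=
  [set p | forall u, A u (tnth p u)].

Lemma measurable_coordinate (u : 'I_n) (A : set T) :
  measurable A -> measurable [set p : n.-tuple T | A (tnth p u)].
Proof.
by move=> mA; rewrite -[X in measurable X]setTI; apply: measurable_tnth.
Qed.

Lemma measurable_rectangle (A : 'I_n -> set T) :
  (forall u, measurable (A u)) -> measurable (rectangle A).
Proof.
move=> mA; apply: (@measurable_forall _ _ _ (fun u => [set p | A u (tnth p u)])) => u.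
exact: measurable_coordinate.
Qed.

(** Rectangles are stable under intersection and generate the product sigma-algebra. *)
Lemma rectangle_measure_unique (R : realType)
    (m1 m2 : {measure set (n.-tuple T) -> \bar R}) :
  (m1 setT < +oo)%E ->
  (forall A, (forall u, measurable (A u)) -> m1 (rectangle A) = m2 (rectangle A)) ->
  forall X, measurable X -> m1 X = m2 X.
Proof.
move=> m1oo m12.
pose G := [set rectangle A | A in [set A | forall u, measurable (A u)]].
have rT : rectangle (fun=> setT) = setT by apply/seteqP; split.
have GT : G setT by exists (fun=> setT) => //= u.
apply: (measure_unique G (fun=> setT)) => //.
- apply/seteqP; split; last first.
    by apply: smallest_sub; [exact: sigma_algebra_measurable|move=> _ [A mA <-]; exact: measurable_rectangle].
  apply: smallest_sub; first exact: smallest_sigma_algebra.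
  rewrite -bigcup_seq => X [u _ [A mA <-]].
  apply: sub_sigma_algebra; exists (fun v => if v == u then A else setT).
    by move=> v /=; case: eqP.
  apply/seteqP; split=> [p /(_ u)|p [_ pu] v]; first by rewrite eqxx.
  by case: eqP => // ->.
- move=> _ _ [A mA <-] [B mB <-]; exists (fun u => A u `&` B u).
    by move=> u; exact: measurableI.
  by apply/seteqP; split=> [p h|p [h1 h2] u]; [split=> u; case: (h u)|split].
- by rewrite bigcup_const //; exists 0%N.
- by move=> _ [A mA <-]; exact: m12.
Qed.
End TupleMeasurability.

Lemma measurable_tuple_bool n (A : set (n.-tuple bool)) : measurable A.
Proof.
pose F (t : n.-tuple bool) : set (n.-tuple bool) :=
  rectangle (fun u => [set tnth t u]) `&` [set _ | A t].
rewrite (_ : A = [set p | exists t, F t p]).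
  apply: measurable_exists => t; apply: measurableI; first exact: measurable_rectangle.
  have [At|nAt] := pselect (A t).
    by rewrite (_ : [set _ | _] = setT) //; apply/seteqP; split.
  by rewrite (_ : [set _ | _] = set0) //; apply/seteqP; split.
apply/seteqP; split=> [p Ap|p [t [/= tp At]]]; first by exists p.
by rewrite (_ : p = t) //; apply: eq_from_tnth.
Qed.

(** * The data given the parameters *)

Section DataLaw.
Variables (R : realType) (M : population R).
Local Notation P := (prob M).

Lemma measurable_params n : measurable_fun setT (params M n).
Proof.
apply/measurable_fun_tnthP => u.
rewrite (_ : _ \o _ = param M u) //.
by apply/funext => w /=; rewrite tnth_mktuple.
Qed.

Definition law_mass n (p : n.-tuple R) (t : n.-tuple bool) : R :=
  fine (law M n p [set t]).

Lemma law_massE n (p : n.-tuple R) t : law M n p [set t] = (law_mass p t)%:E.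
Proof.
rewrite /law_mass fineK //.
by apply: (finite_kernel_measure (law M n) p); exact: measurable_tuple_bool. Qed.

Lemma law_mass_ge0 n (p : n.-tuple R) t : 0 <= law_mass p t.
Proof. by rewrite fine_ge0. Qed.

Lemma law_pred n (p : n.-tuple R) (B : pred (n.-tuple bool)) :
  law M n p [set t | B t] = (\sum_(t | B t) law_mass p t)%:E.
Proof.
rewrite (@measure_fin_partition _ (n.-tuple bool) _ (law M n p) (n.-tuple bool)
  (fun t => t) (fun t => [set _ | B t])).
  rewrite (big_mkcond B) -sumEFin; apply: eq_bigr => t _.
  case: ifPn => Bt.
    rewrite -law_massE; congr (law M n p _).
    by apply/seteqP; split=> [? []|? ->].
  by rewrite (_ : _ `&` _ = set0) ?measure0 //; apply/seteqP; split=> [? []|].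
by move=> y; exact: measurable_tuple_bool.
Qed.

Lemma law_mass_sum1 n (p : n.-tuple R) : \sum_t law_mass p t = 1.
Proof.
have := law_pred p xpredT; rewrite (_ : [set t | _] = setT); last by apply/seteqP; split.
by rewrite prob_kernel => -[].
Qed.

Lemma measurable_law_mass n t : measurable_fun setT (fun p : n.-tuple R => law_mass p t).
Proof.
apply: measurableT_comp => //.
exact: (measurable_kernel (law M n) _ (measurable_tuple_bool [set t])).
Qed.

(** A finite function of the time, so that the outcomes form a [finType] over which to sum. *)
Definition data n m (w : Defs.space M) : {ffun 'I_m -> n.-tuple bool} :=
  [ffun k : 'I_m => [tuple sample M u k w | u < n]].

Lemma data_eq n m (x : {ffun 'I_m -> n.-tuple bool}) :
  [set w | data n m w = x] = [set w | forall k : 'I_m, [tuple sample M u k w | u < n] = x k].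
Proof.
apply/seteqP; split=> w /= h; first by move=> k; rewrite -h ffunE.
by apply/ffunP => k; rewrite ffunE h.
Qed.

Lemma measurable_data n m (x : {ffun 'I_m -> n.-tuple bool}) :
  measurable [set w | data n m w = x].
Proof.
rewrite (_ : [set _ | _] = [set w | forall (k : 'I_m), [set w | forall u : 'I_n, (sample M u k @^-1` [set tnth (x k) u]) w] w]).
  apply: measurable_forall => k; apply: measurable_forall => u.
  by rewrite -[X in measurable X]setTI; exact: measurable_funP.
apply/seteqP; split=> w /=; first by move=> <- k u; rewrite ffunE tnth_mktuple.
by move=> h; apply/ffunP => k; rewrite ffunE; apply: eq_from_tnth => u; rewrite tnth_mktuple h.
Qed.

Definition data_mass n m (p : n.-tuple R) (x : {ffun 'I_m -> n.-tuple bool}) : R :=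
  \prod_(k < m) law_mass p (x k).

Lemma data_mass_ge0 n m p x : 0 <= @data_mass n m p x.
Proof. by apply: prodr_ge0 => k _; exact: law_mass_ge0. Qed.

Lemma measurable_data_mass n m x : measurable_fun setT (fun p => @data_mass n m p x).
Proof. by apply: measurable_prod => k _; exact: measurable_law_mass. Qed.

Lemma measurable_data_mass_params n m x :
  measurable_fun setT (fun w => (@data_mass n m (params M n w) x)%:E).
Proof.
apply/measurable_EFinP; apply: (measurableT_comp (measurable_data_mass x)).
exact: measurable_params.
Qed.

Lemma prob_data n m (A : set (n.-tuple R)) (x : {ffun 'I_m -> n.-tuple bool}) :
  measurable A ->
  P ([set w | data n m w = x] `&` params M n @^-1` A) =
  (\int[P]_(w in params M n @^-1` A) (data_mass (params M n w) x)%:E)%E.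
Proof.
move=> mA; have := sample_iid M x mA.
rewrite data_eq setIC => ->; apply: eq_integral => w _.
by rewrite /data_mass -prodEFin; apply: eq_bigr => k _; rewrite law_massE.
Qed.

End DataLaw.


(** * Conditioning on the parameters, and concentration of the frequencies *)

Lemma mem_set_bool (T : Type) (b : T -> bool) (p : T) : (p \in [set p | b p]) = b p.
Proof. by apply/idP/idP; rewrite inE. Qed.

Section Conditioning.
Variables (R : realType) (M : population R).
Local Notation P := (prob M).

Lemma measurable_params_preimage n (A : set (n.-tuple R)) :
  measurable A -> measurable (params M n @^-1` A).
Proof.
by move=> mA; rewrite -[X in measurable X]setTI; apply: measurable_params.
Qed.

Lemma measurable_data_params n m (A : {ffun 'I_m -> n.-tuple bool} -> set (n.-tuple R)) :
  (forall x, measurable (A x)) ->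
  measurable [set w | A (data n m w) (params M n w)].
Proof.
move=> mA; apply: (@measurable_fin_partition _ _ _ (data n m)
  (fun x => params M n @^-1` A x)) => x.
by apply: measurableI; [exact: measurable_data|exact: measurable_params_preimage].
Qed.

(** Splitting over the values of the data turns the probability into an integral, over the
    parameters, of a conditional probability that the second hypothesis bounds for each [p]. *)
Lemma conditional_bound n m (A : {ffun 'I_m -> n.-tuple bool} -> set (n.-tuple R)) (e : R) :
  (forall x, measurable (A x)) ->
  (forall p, \sum_(x | p \in A x) data_mass M p x <= e) ->
  (P [set w | A (data n m w) (params M n w)] <= e%:E)%E.
Proof.
move=> mA Ae.
pose f x (w : Defs.space M) : \bar R := ((fun w => (data_mass M (params M n w) x)%:E) \_ (params M n @^-1` A x)) w.
rewrite (@measure_fin_partition _ _ _ P _ (data n m) (fun x => params M n @^-1` A x)); last first.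
  by move=> x; apply: measurableI; [exact: measurable_data|exact: measurable_params_preimage].
have mf x : measurable_fun setT (f x).
  apply/(measurable_restrictT _ (measurable_params_preimage (mA x))).1.
  by apply: measurable_funTS; exact: measurable_data_mass_params.
have f0 x w : (0 <= f x w)%E.
  by rewrite /f; apply: erestrict_ge0 => ? _; rewrite lee_fin data_mass_ge0.
have -> : (\sum_x P ([set w | data n m w = x] `&` params M n @^-1` A x) =
    \int[P]_w (\sum_x f x w))%E.
  rewrite ge0_integral_sum //; apply: eq_bigr => x _.
  by rewrite prob_data //; exact: integral_mkcond.
have -> : e%:E = (\int[P]_w (cst e%:E w))%E.
  by rewrite integral_cst // [X in (_ * X)%E](probability_setT P) mule1.
apply: ge0_le_integral => //.
- by move=> w _; apply: sume_ge0.
- exact: emeasurable_sum.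
- move=> w _; apply: le_trans (_ : ((\sum_(x | params M n w \in A x) data_mass M (params M n w) x)%:E <= _)%E); last first.
    by rewrite lee_fin.
  rewrite -sumEFin [leRHS]big_mkcond; apply: lee_sum => x _.
  rewrite /f patchE; have -> : (w \in params M n @^-1` A x) = (params M n w \in A x).
    by apply/idP/idP; rewrite !inE.
  by [].
Qed.

Lemma prob_data_pred n m (D : pred {ffun 'I_m -> n.-tuple bool}) (A : set (n.-tuple R)) :
  measurable A ->
  P ([set w | D (data n m w)] `&` params M n @^-1` A) =
  (\int[P]_(w in params M n @^-1` A) (\sum_(x | D x) data_mass M (params M n w) x)%:E)%E.
Proof.
move=> mA.
have mA' := measurable_params_preimage mA.
rewrite (@measure_fin_partition _ _ _ P _ (data n m)
   (fun x => [set w | D x] `&` params M n @^-1` A)); last first.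
  move=> x; apply: measurableI; first exact: measurable_data.
  apply: measurableI => //.
  by case: (D x); [rewrite (_ : [set _ | _] = setT) //|rewrite (_ : [set _ | _] = set0) //]; apply/seteqP; split.
under [in RHS]eq_integral do rewrite -sumEFin big_mkcond /=.
rewrite ge0_integral_sum //.
- apply: eq_bigr => x _; case: (boolP (D x)) => Dx.
    rewrite -prob_data //; congr (P (_ `&` _)).
    by apply/seteqP; split=> [? []|].
  rewrite (_ : _ `&` _ = set0) ?measure0 ?integral0 //.
  by apply/seteqP; split=> [? [_ []]|].
- move=> x; case: (D x) => //; apply: measurable_funTS.
  exact: measurable_data_mass_params.
- by move=> x w _; case: (D x) => //; rewrite lee_fin data_mass_ge0.
Qed.

Definition data_matrix n m (x : {ffun 'I_m -> n.-tuple bool}) : 'M[bool]_(m, n) :=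
  \matrix_(k, v) tnth (x k) v.

(** The probability, given the parameters [p], that both samples are 1: the value that [freq]
    estimates. *)
Definition pair_law n (p : n.-tuple R) (v w : 'I_n) : R :=
  \sum_(t | tnth t v && tnth t w) law_mass M p t.

Lemma measurable_pair_law n (v w : 'I_n) : measurable_fun setT (fun p => pair_law p v w).
Proof.
rewrite /pair_law; under eq_fun do rewrite big_mkcond /=.
apply: measurable_sum => t; case: (_ && _) => //; exact: measurable_law_mass.
Qed.

Definition deviates n m (eta : R) (x : {ffun 'I_m -> n.-tuple bool}) (p : n.-tuple R) :=
  exists vw : 'I_n * 'I_n, eta < `|freq R (data_matrix x) vw.1 vw.2 - pair_law p vw.1 vw.2|.

Lemma measurable_deviates1 n (c eta : R) (vw : 'I_n * 'I_n) :
  measurable [set p | eta < `|c - pair_law p vw.1 vw.2|].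
Proof.
rewrite (_ : [set _ | _] = (fun p => `|c - pair_law p vw.1 vw.2|) @^-1` `]eta, +oo[%classic); last first.
  by apply/seteqP; split=> p /=; rewrite in_itv /= andbT.
rewrite -[X in measurable X]setTI.
apply: (@measurableT_comp _ _ _ _ _ _ (@Num.norm R R)) => //.
by apply: measurable_funB => //; exact: measurable_pair_law.
Qed.

Lemma measurable_deviates n m eta (x : {ffun 'I_m -> n.-tuple bool}) :
  measurable [set p | deviates eta x p].
Proof.
apply: (@measurable_exists _ _ _ (fun vw => [set p | eta < `|freq R (data_matrix x) vw.1 vw.2 - pair_law p vw.1 vw.2|])) => vw.
exact: measurable_deviates1.
Qed.

(** A union bound over the [n ^ 2] ordered pairs, diagonal included, with the Chernoff bound at each
    fixed [p]. *)
Lemma prob_deviates n m (eta : R) : (0 < m)%N -> 0 <= eta <= 1 ->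
  (P [set w | deviates eta (data n m w) (params M n w)] <=
   (2 * n%:R ^+ 2 * expR (- (m%:R * eta ^+ 2 / 8)))%:E)%E.
Proof.
move=> m0 eta01.
have m0' : 0 < m%:R :> R by rewrite ltr0n.
pose F (vw : 'I_n * 'I_n) : set (Defs.space M) :=
  [set w | [set p | eta < `|freq R (data_matrix (data n m w)) vw.1 vw.2 - pair_law p vw.1 vw.2|] (params M n w)].
have mF vw : measurable (F vw).
  apply: (measurable_data_params (A := fun x => [set p | eta < `|freq R (data_matrix x) vw.1 vw.2 - pair_law p vw.1 vw.2|])).
  by move=> x; exact: measurable_deviates1.
apply: le_trans (measure_exists_le P mF) _.
have -> : 2 * n%:R ^+ 2 * expR (- (m%:R * eta ^+ 2 / 8)) =
    \sum_(vw : 'I_n * 'I_n) 2 * expR (- (m%:R * eta ^+ 2 / 8)).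
  by rewrite sumr_const card_prod card_ord -[RHS]mulr_natr natrM; ring.
rewrite -sumEFin; apply: lee_sum => vw _.
apply: (conditional_bound (A := fun x => [set p | eta < `|freq R (data_matrix x) vw.1 vw.2 - pair_law p vw.1 vw.2|])).
  by move=> x; exact: measurable_deviates1.
move=> p; pose B : pred (n.-tuple bool) := fun t => tnth t vw.1 && tnth t vw.2.
have H := chernoff_frequency (law_mass_ge0 M p) (law_mass_sum1 M p) m B eta01.
apply: (le_trans _ H).
rewrite le_eqVlt; apply/orP; left; apply/eqP/eq_bigl => x.
apply: (etrans (mem_set_bool _ _)); rewrite -(ltr_pM2l m0'); congr (_ < _).
rewrite -[X in X * `|_|](ger0_norm (ltW m0')) -normrM mulrBr /freq mulrC divfK ?gt_eqF //.
by congr (`|_ - _|); apply: eq_bigr => k _; rewrite !mxE.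
Qed.

End Conditioning.


Section Law.
Variables (R : realType) (M : population R).
Local Notation P := (prob M).
Local Notation pair_law := (pair_law M).

Lemma pair_law_diag n (p : n.-tuple R) (v : 'I_n) : open_cube p -> pair_law p v v = tnth p v.
Proof.
move=> cp; have /andP[p0 p1] := cp v.
have := law_bernoulli M v [set true] cp.
rewrite /bernoulli_prob !ltW //= fsbig_set1 /=.
rewrite (_ : [set x | _] = [set t : n.-tuple bool | tnth t v && tnth t v]).
  by rewrite law_pred => -[].
by apply/seteqP; split=> t /=; rewrite andbb // => ->.
Qed.

Lemma pair_law01 n (p : n.-tuple R) (v w : 'I_n) : 0 <= pair_law p v w <= 1.
Proof.
rewrite sumr_ge0 ?andTb => [|t _]; last exact: law_mass_ge0.
rewrite -(law_mass_sum1 M p) [leRHS](bigID (fun t => tnth t v && tnth t w)) /=.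
by rewrite lerDl sumr_ge0 // => t _; exact: law_mass_ge0.
Qed.

(** Two bits are independent exactly when their covariance is 0, so that association can be tested
    on frequencies of ones. *)
Lemma mutual_information_eq0 n (p : n.-tuple R) (u v : 'I_n) :
  (mutual_information (law M n p) (fun x => tnth x u) (fun x => tnth x v) == 0) =
  (pair_law p u v == pair_law p u u * pair_law p v v).
Proof.
pose F a b := \sum_(t | (tnth t u == a) && (tnth t v == b)) law_mass M p t.
have Fj a b : fine (law M n p [set t | tnth t u = a /\ tnth t v = b]) = F a b.
  rewrite (_ : [set t | _] = [set t : n.-tuple bool | (tnth t u == a) && (tnth t v == b)]) ?law_pred //.
  by apply/seteqP; split=> t /= => [[-> ->]|/andP[/eqP -> /eqP ->]]; rewrite ?eqxx.
have Fu a : \sum_b F a b = \sum_(t | tnth t u == a) law_mass M p t.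
  rewrite (partition_big (fun t => tnth t v) predT) //=.
have Fv b : \sum_a F a b = \sum_(t | tnth t v == b) law_mass M p t.
  rewrite (partition_big (fun t => tnth t u) predT) //=.
  by apply: eq_bigr => a _; apply: eq_bigl => t; rewrite andbC.
have lu a : fine (law M n p [set t | tnth t u = a]) = \sum_b F a b.
  rewrite Fu (_ : [set t | _] = [set t : n.-tuple bool | (tnth t u == a)]) ?law_pred //.
  by apply/seteqP; split=> t /= => [->|/eqP ->].
have lv b : fine (law M n p [set t | tnth t v = b]) = \sum_a F a b.
  rewrite Fv (_ : [set t | _] = [set t : n.-tuple bool | (tnth t v == b)]) ?law_pred //.
  by apply/seteqP; split=> t /= => [->|/eqP ->].
have F0 a b : 0 <= F a b by apply: sumr_ge0 => t _; exact: law_mass_ge0.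
have F1 : \sum_a \sum_b F a b = 1.
  rewrite -(law_mass_sum1 M p) (partition_big (fun t => tnth t u) predT) //=.
  by apply: eq_bigr => a _; exact: Fu.
have := two_by_two_mutual_information F0 F1; rewrite Fu Fv.
have -> : mutual_information (law M n p) (fun x => tnth x u) (fun x => tnth x v) =
    \sum_a \sum_b F a b * ln (F a b / ((\sum_b F a b) * (\sum_a F a b))).
  by apply: eq_bigr => a _; apply: eq_bigr => b _; rewrite -lu -lv -Fj.
move=> ->; rewrite /pair_law /F.
congr (_ == _ * _); apply: eq_bigl => t; rewrite ?andbb ?eqb_id //.
Qed.

End Law.

(** * The parameters *)

Section Params.
Variables (R : realType) (M : population R).
Local Notation P := (prob M).

(** User 0 stands for every user, as the parameters have a common law. *)
Definition marginal (X : set R) : \bar R := P [set w | X (param M 0 w)].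

Lemma measurable_param u (X : set R) : measurable X -> measurable [set w | X (param M u w)].
Proof. by move=> mX; rewrite -[X in measurable X]setTI; exact: measurable_funP. Qed.

Lemma marginal_density X : measurable X ->
  marginal X = (\int[lebesgue_measure]_(x in X) (density M x)%:E)%E.
Proof.
move=> mX; have := param_iid M (A := fun _ : 'I_1 => X) (fun=> mX).
rewrite big_ord1 => <-; congr (P _).
by apply/seteqP; split=> w /= => [h i|/(_ ord0)//]; rewrite ord1.
Qed.

Lemma marginalT : marginal setT = 1%E.
Proof. exact: probability_setT. Qed.

Lemma prob_params n (A : 'I_n -> set R) : (forall u, measurable (A u)) ->
  P (params M n @^-1` rectangle A) = (\prod_(u < n) marginal (A u))%E.
Proof.
move=> mA; under eq_bigr => u _ do rewrite marginal_density //.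
rewrite -param_iid //; congr (P _).
by apply/seteqP; split=> w /= h u; move: (h u); rewrite /= tnth_mktuple.
Qed.

Lemma prob_param2 u v X Y : u != v -> measurable X -> measurable Y ->
  P [set w | X (param M u w) /\ Y (param M v w)] = (marginal X * marginal Y)%E.
Proof.
(* The smallest system that contains both users; the others are left unconstrained. *)
move=> uv mX mY; pose n := (maxn u v).+1.
have un : (u < n)%N by rewrite ltnS leq_maxl.
have vn : (v < n)%N by rewrite ltnS leq_maxr.
pose u' := Ordinal un; pose v' := Ordinal vn.
have uv' : v' != u' by rewrite -val_eqE /= eq_sym.
pose A (i : 'I_n) := if i == u' then X else if i == v' then Y else setT.
have mA i : measurable (A i) by rewrite /A; case: ifP => // _; case: ifP.
have := prob_params mA.
rewrite (bigD1 u') // (bigD1 v') //= big1 => [|i /andP[/negbTE iu /negbTE iv]]; last first.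
  by rewrite /A iu iv marginalT.
rewrite /A !eqxx (negbTE uv') mule1 => <-; congr (P _).
apply/seteqP; split=> w /=.
  move=> [hX hY] i; rewrite tnth_mktuple /A.
  by case: eqP => [->|] //; case: eqP => [->|].
move=> h; move: (h u') (h v'); rewrite /A !eqxx (negbTE uv') !tnth_mktuple.
by split.
Qed.

Lemma prob_param1 u X : measurable X -> P [set w | X (param M u w)] = marginal X.
Proof.
move=> mX; rewrite -[RHS]mule1 -marginalT -(@prob_param2 u u.+1) //.
  by congr (P _); apply/seteqP; split=> [w|w []].
by rewrite neq_ltn ltnSn.
Qed.

Lemma prob_param_outside u : P [set w | (~` `]0, 1[%classic) (param M u w)] = 0%E.
Proof.
have m01 : measurable (~` `]0, 1[%classic : set R) by exact: measurableC.
rewrite prob_param1 // marginal_density //; apply: integral0_eq => x /= h.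
by rewrite density_out //; apply/negP; move: h; rewrite in_itv.
Qed.

Lemma measurable_density : measurable_fun setT (density M).
Proof.
have m01 : measurable (`]0, 1[%classic : set R) by [].
rewrite -(setUv (`]0, 1[%classic : set R)); apply/measurable_funU => //.
  exact: measurableC.
split.
  by apply: subspace_continuous_measurable_fun => //; exact: density_continuous.
apply: (eq_measurable_fun (cst (0 : R))) => // x.
rewrite inE /= in_itv /= => /negP h; exact/esym/density_out.
Qed.

Lemma marginal_interval (delta eta a : R) : 0 <= eta ->
  (forall p : R, 0 < p < 1 -> density M p <= delta) -> 0 <= delta ->
  (marginal `[a, (a + eta)%R]%classic <= (delta * eta)%:E)%E.
Proof.
move=> e0 dd d0; rewrite marginal_density //.
have dens_ge0 x : 0 <= density M x.
  have [/[dup] x01|/density_out -> //] := boolP (0 < x < 1).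
  have [d1 [d2 [d10 d20 h]]] := density_bounds M.
  by move=> /h /andP[+ _]; apply: le_trans; exact: ltW.
apply: (@le_trans _ _ (\int[lebesgue_measure]_(x in `[a, (a + eta)%R]) (cst delta%:E x))%E).
  apply: ge0_le_integral => //.
  - by move=> x _; rewrite lee_fin.
  - by apply/measurable_EFinP/measurable_funTS; exact: measurable_density.
  - move=> x _; rewrite lee_fin.
    by have [/dd//|/density_out ->] := boolP (0 < x < 1).
rewrite integral_cst // [X in (_ * X)%E](lebesgue_measure_itv `[a, (a + eta)%R]) /= lte_fin.
case: ltP => _; last by rewrite mule0 lee_fin mulr_ge0.
by rewrite -EFinB -EFinM lee_fin addrC addKr.
Qed.

End Params.


(** * Small-ball probabilities and null events *)

Section SmallBall.
Context d (T : measurableType d) (R : realType) (P : probability T R).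

Lemma measurable_norm_le (h : T -> R) (e : R) : measurable_fun setT h ->
  measurable [set w | `|h w| <= e].
Proof.
move=> mh; rewrite (_ : [set _ | _] = (fun w => `|h w|) @^-1` `]-oo, e]%classic); last first.
  by apply/seteqP; split=> p /=; rewrite in_itv.
rewrite -[X in measurable X]setTI.
exact: (@measurableT_comp _ _ _ _ _ _ (@Num.norm R R)).
Qed.

(** Continuity from above along the events [|h| <= 1/(j+1)], which decrease to [h = 0]. This gives
    convergence without a rate, for the parameter gaps and edge strengths of a fixed system. *)
Lemma small_ball_cvg (h : T -> R) (e : nat -> R) : measurable_fun setT h ->
  P [set w | h w = 0] = 0%E -> e n @[n --> \oo] --> 0 ->
  fine (P [set w | `|h w| <= e n]) @[n --> \oo] --> (0 : R).
Proof.
move=> mh h0 e0; pose F (j : nat) := [set w | `|h w| <= j.+1%:R^-1].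
have mF (r : R) : measurable [set w | `|h w| <= r] by exact: measurable_norm_le.
have capF : \bigcap_j F j = [set w | h w = 0].
  apply/seteqP; split=> [w Fw|w hw j _]; last by rewrite /F /= hw normr0 invr_ge0.
  apply/eqP; rewrite -normr_le0 leNgt; apply/negP => hp.
  (* At this index [j], [1/(j+1)] is smaller than [|h w|]. *)
  have /(_ Logic.I) := Fw (Num.truncn `|h w|^-1); rewrite /F /= leNgt => /negP[].
  by rewrite invf_plt ?posrE // truncnS_gt.
have := @nonincreasing_cvg_mu _ _ _ P F.
rewrite capF => cvF.
have {}cvF : P \o F @ \oo --> 0%E.
  rewrite -h0; apply: cvF; first by rewrite ltey_eq fin_num_measure //; exact: mF.
  - by move=> j; exact: mF.
  - by rewrite -capF; apply: bigcapT_measurable => j; exact: mF.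
  - move=> i j ij; apply/subsetPset => w /=; rewrite /F /= => /le_trans; apply.
    by rewrite lef_pV2 ?posrE // ler_nat.
have /fine_cvgP[_ /cvgr0Pnorm_lt cvF'] := cvF.
apply/cvgr0Pnorm_lt => eps eps0.
have [j _ /(_ j (leqnn j)) Fj] := cvF' _ eps0.
have j0 : 0 < j.+1%:R^-1 :> R by rewrite invr_gt0.
move/cvgr0Pnorm_lt/(_ _ j0) : e0; apply: filterS => n en.
apply: le_lt_trans Fj; rewrite /= !ger0_norm ?fine_ge0 //.
rewrite fine_le ?fin_num_measure //; [exact: mF|].
apply: le_measure; rewrite ?inE //; first exact: mF.
by move=> w /= /le_trans; apply; rewrite ltW // (le_lt_trans (ler_norm _)).
Qed.
End SmallBall.

Section Regular.
Variables (R : realType) (M : population R).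
Local Notation P := (prob M).

(** Cut the unit interval into [N.+1] equal cells: a tie puts both parameters into one cell, with
    probability at most [(N+1) (d2/(N+1))^2]. *)
Lemma prob_param_eq u v : u != v -> P [set w | param M u w = param M v w] = 0%E.
Proof.
move=> uv; have [d1 [d2 [d10 d20 dens]]] := density_bounds M.
have dd p : 0 < p < 1 -> density M p <= d2 by move=> /dens/andP[].
set E := [set w | _].
have mE : measurable E.
  rewrite (_ : E = (fun w => param M u w - param M v w) @^-1` [set 0]).
    by rewrite -[X in measurable X]setTI; apply: measurable_funB.
  apply/seteqP; split=> w; first by rewrite /E /= => ->; rewrite subrr.
  by move/eqP; rewrite subr_eq0 => /eqP.
have bound (N : nat) : (P E <= (d2 ^+ 2 * N.+1%:R^-1)%:E)%E.
  pose c (i : 'I_N.+1) : set R := `[i%:R / N.+1%:R, (i%:R / N.+1%:R + N.+1%:R^-1)%R]%classic.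
  pose F (i : 'I_N.+1) := [set w | c i (param M u w) /\ c i (param M v w)].
  (* The cells cover the unit interval only; leaving it is a null event. *)
  pose O := [set w | (~` `]0, 1[%classic) (param M u w)].
  have mO : measurable O by apply: measurable_param; exact: measurableC.
  have mc i : measurable (c i) by exact: measurable_itv.
  have mF i : measurable (F i).
    exact: (measurableI _ _ (measurable_param M u (mc i)) (measurable_param M v (mc i))).
  have N0 : 0 < N.+1%:R :> R by rewrite ltr0n.
  have mX : measurable [set w | exists i, F i w] by exact: measurable_exists.
  apply: (@le_trans _ _ (P (O `|` [set w | exists i, F i w]))).
    apply: le_measure; rewrite ?inE //; first exact: measurableU.
    move=> w Ew; have [|nO] := pselect (O w); first by left.
    right; have {nO} : 0 < param M u w < 1.
      by apply: contrapT => h; apply: nO; rewrite /O /= in_itv.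
    set x := param M u w => /andP[x0 x1].
    have xN0 : 0 <= x * N.+1%:R by rewrite mulr_ge0 // ltW.
    have /andP[t1 t2] := truncn_itv xN0.
    have tN : (Num.truncn (x * N.+1%:R) < N.+1)%N.
      by rewrite -(ltr_nat R) (le_lt_trans t1) // gtr_pMl.
    exists (Ordinal tN); rewrite /F /c /= -Ew -/x.
    suff h : (Num.truncn (x * N.+1%:R))%:R / N.+1%:R <= x <=
        (Num.truncn (x * N.+1%:R))%:R / N.+1%:R + N.+1%:R^-1.
      by rewrite !in_itv /= h.
    rewrite ler_pdivrMr // t1 /= -[X in _ + X]mul1r -mulrDl ler_pdivlMr //.
    by rewrite natr1 ltW.
  rewrite (@le_trans _ _ (P O + \sum_i P (F i))%E) //.
    rewrite (le_trans (measureU2 _ _ _)) // leeD2l //.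
    exact: measure_exists_le.
  rewrite prob_param_outside add0e.
  apply: (@le_trans _ _ (\sum_(i < N.+1) ((d2 * N.+1%:R^-1) ^+ 2)%:E)%E).
    apply: lee_sum => i _; rewrite (prob_param2 M uv (mc i) (mc i)).
    rewrite expr2 EFinM; apply: lee_pmul; rewrite ?measure_ge0 //.
      by apply: marginal_interval => //; exact: ltW.
    by apply: marginal_interval => //; exact: ltW.
  rewrite sumEFin sumr_const card_ord lee_fin -mulr_natr le_eqVlt; apply/orP; left; apply/eqP.
  by field; rewrite gt_eqF.
have PEfin : P E \is a fin_num by rewrite fin_num_measure.
rewrite -(fineK PEfin); congr EFin; apply/eqP.
rewrite eq_le fine_ge0 // andbT leNgt; apply/negP => r0.
(* Were the probability of [E] positive, this [N] would bring the bound below it. *)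
have := bound (Num.truncn (d2 ^+ 2 / fine (P E))).
rewrite -[leLHS](fineK PEfin) lee_fin leNgt ltr_pdivrMr // mulrC -ltr_pdivrMr //.
by rewrite truncnS_gt.
Qed.

End Regular.


Section RegularAe.
Variables (R : realType) (M : population R).
Local Notation P := (prob M).

(** The second clause is [assocP] restated with covariances in place of mutual information. *)
Definition regular n (p : n.-tuple R) := open_cube p /\
  forall u v : 'I_n, u != v ->
    assoc M u v = (pair_law M p u v != pair_law M p u u * pair_law M p v v).

Lemma regular_ae n : {ae P, forall w, regular (params M n w)}.
Proof.
have cube : {ae P, forall w, forall u : 'I_n, 0 < param M u w < 1}.
  apply: filter_forall => u.
  exists [set w | (~` `]0, 1[%classic) (param M u w)]; split.
  - by apply: measurable_param; exact: measurableC.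
  - exact: prob_param_outside.
  - by move=> w /= h; rewrite in_itv.
have mi : {ae P, forall w, forall uv : 'I_n * 'I_n, uv.1 != uv.2 ->
    assoc M uv.1 uv.2 = (pair_law M (params M n w) uv.1 uv.2 !=
      pair_law M (params M n w) uv.1 uv.1 * pair_law M (params M n w) uv.2 uv.2)}.
  apply: filter_forall => -[u v] /=.
  have [->|uv] := eqVneq u v; first by apply: nearW.
  apply: filterS (assocP M uv) => w /= [h1 h2] _.
  rewrite -mutual_information_eq0; case: (boolP (assoc M u v)) => [/h1 I0|/h2 ->].
    by rewrite gt_eqF.
  by rewrite eqxx.
apply: filterS2 cube mi => w cu mw; split.
  by move=> u; rewrite tnth_mktuple.
by move=> u v uv; exact: (mw (u, v)).
Qed.
End RegularAe.

(** * The data of a group and the other parameters *)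

Section GroupIndep.
Variables (R : realType) (M : population R) (n m : nat) (u : 'I_n).
Local Notation P := (prob M).
Let g := Defs.group (assoc M) u.

(** The length stays [n], so that [freq] and [impostor] apply to masked data as well. *)
Definition mask_tuple (t : n.-tuple bool) : n.-tuple bool :=
  [tuple (v \in g) && tnth t v | v < n].

Definition mask_data (x : {ffun 'I_m -> n.-tuple bool}) : {ffun 'I_m -> n.-tuple bool} :=
  [ffun k => mask_tuple (x k)].

(* law_group compares parameters in the open cube only, so the coordinates outside
   the group are reset to 1/2 rather than to 0. *)
Definition reset_params (p : n.-tuple R) : n.-tuple R :=
  [tuple if v \in g then tnth p v else 2^-1 | v < n].

Definition mask_law (y : {ffun 'I_m -> n.-tuple bool}) (p : n.-tuple R) : R :=
  \sum_(x | mask_data x == y) data_mass M p x.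

Lemma mask_tuple_eq t t' : mask_tuple t = mask_tuple t' <->
  {in g, forall v, tnth t v = tnth t' v}.
Proof.
split=> [e v vg|e].
  by have := congr1 (fun s => tnth s v) e; rewrite !tnth_mktuple vg.
apply: eq_from_tnth => v; rewrite !tnth_mktuple.
by have [/e ->|] := boolP (v \in g).
Qed.

Lemma mask_law_prod y p : mask_law y p =
  \prod_(k < m) \sum_(t | mask_tuple t == y k) law_mass M p t.
Proof.
rewrite bigA_distr_big_dep; apply: eq_bigl => x.
apply/eqP/familyP => [<- k|h]; first by rewrite unfold_in ffunE.
by apply/ffunP => k; rewrite ffunE; have := h k; rewrite unfold_in => /eqP.
Qed.

(** The masked law is a product over the times, and [law_group] makes each factor depend on the
    parameters of the group alone. *)
Lemma mask_law_reset y p : open_cube p -> mask_law y p = mask_law y (reset_params p).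
Proof.
move=> cp; rewrite !mask_law_prod; apply: eq_bigr => k _.
have cr : open_cube (reset_params p).
  by move=> v; rewrite tnth_mktuple; case: ifP => _; [exact: cp|apply/andP; split; lra].
(* [law_group] takes a representative tuple; if [y k] is not a masked tuple, both sums are empty. *)
have [/existsP[t /eqP tk]|/existsPn no] := boolP [exists t, mask_tuple t == y k]; last first.
  by rewrite !big_pred0 // => t; apply: negbTE.
apply: EFin_inj; rewrite -!law_pred.
have -> : [set t0 | mask_tuple t0 == y k] = [set y | {in g, forall v, tnth y v = tnth t v}].
  by apply/seteqP; split=> t' /=; rewrite -tk; [move/eqP/mask_tuple_eq|move/mask_tuple_eq/eqP].
by apply: law_group => // v vg; rewrite tnth_mktuple vg.
Qed.

Lemma measurable_mask_law y : measurable_fun setT (mask_law y).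
Proof.
rewrite /mask_law; under eq_fun do rewrite big_mkcond /=.
apply: measurable_sum => x; case: (_ == _) => //; exact: measurable_data_mass.
Qed.

Lemma measurable_reset : measurable_fun setT reset_params.
Proof.
apply/measurable_fun_tnthP => v.
rewrite (_ : _ \o _ = if v \in g then (fun p : n.-tuple R => tnth p v) else cst 2^-1).
  by case: ifP => _ //; exact: measurable_tnth.
by apply/funext => p /=; rewrite tnth_mktuple; case: ifP.
Qed.

Variable A : 'I_n -> set R.
Hypotheses (mA : forall v, measurable (A v)) (A_out : forall v, v \in g -> A v = setT).

(** The reset parameters depend on the group only, and [A] constrains only the other users. It is
    enough to let [C] be a rectangle, where both sides are products of marginals. *)
Lemma reset_indep (C : set (n.-tuple R)) : measurable C ->
  P ((reset_params \o params M n) @^-1` C `&` params M n @^-1` rectangle A) =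
  (P ((reset_params \o params M n) @^-1` C) * P (params M n @^-1` rectangle A))%E.
Proof.
move=> mC.
have mB : measurable (params M n @^-1` rectangle A).
  by apply: measurable_params_preimage; exact: measurable_rectangle.
have mphi : measurable_fun setT (reset_params \o params M n).
  by apply: measurableT_comp; [exact: measurable_reset|exact: measurable_params].
have B01 : (0 <= fine (P (params M n @^-1` rectangle A))) by rewrite fine_ge0.
pose k : {nonneg R} := NngNum B01.
have kE : k%:num%:E = P (params M n @^-1` rectangle A) by rewrite /= fineK // fin_num_measure.
pose phi := reset_params \o params M n.
pose m1 : {measure set (n.-tuple R) -> \bar R} := pushforward (mrestr P mB) phi.
pose m2 : {measure set (n.-tuple R) -> \bar R} := mscale k (pushforward P phi).
suff : m1 mphi C = m2 mphi C by rewrite /m1 /m2 /= /mscale /= /pushforward /mrestr kE muleC.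
apply: rectangle_measure_unique => // [|D mD].
  by rewrite /m1 /= /pushforward /mrestr preimage_setT setTI ltey_eq fin_num_measure.
rewrite /m1 /m2 /= /mscale /= /pushforward /mrestr kE /=.
have pre (B : 'I_n -> set R) : (forall v, v \notin g -> D v 2^-1) ->
    (forall v, v \in g -> B v = setT) ->
    (reset_params \o params M n) @^-1` rectangle D `&` params M n @^-1` rectangle B =
    params M n @^-1` rectangle (fun v => if v \in g then D v else B v).
  move=> D2 Bg; apply/seteqP; split=> w /=.
    move=> [h1 h2] v; case: ifPn => vg; last exact: h2.
    by have := h1 v; rewrite tnth_mktuple vg.
  move=> h; split=> v; have := h v.
    by rewrite [X in _ -> D v X]tnth_mktuple; case: ifPn => // /D2.
  by case: ifPn => // /Bg ->.
(* Outside the group a reset coordinate is always 1/2, so a rectangle that misses this value has an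
   empty preimage. *)
have [D2|nD2] := pselect (forall v, v \notin g -> D v 2^-1); last first.
  rewrite (_ : _ @^-1` rectangle D = set0) ?set0I ?measure0 ?mule0 //.
  apply/seteqP; split=> w // h; apply: nD2 => v vg.
  by have := h v; rewrite /= tnth_mktuple (negbTE vg).
have e1 := pre A D2 A_out.
have := pre (fun=> setT) D2 (fun v _ => erefl).
rewrite [X in _ `&` X](_ : _ = setT) ?setIT; last by apply/seteqP; split=> // w _ v.
move=> e2; rewrite [X in P X = _]e1 [X in (_ * P X)%E]e2 !prob_params //; last 2 first.
- by move=> v; case: ifP.
- by move=> v; case: ifP.
rewrite (bigID (mem g)) /= [X in (_ = X * _)%E](bigID (mem g)) /= [X in (_ = _ * X)%E](bigID (mem g)) /=.
rewrite [X in (_ = X * _ * _)%E]big1 ?mul1e; last by move=> v vg; rewrite A_out // marginalT.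
rewrite [X in (_ = _ * (_ * X))%E]big1 ?mule1; last by move=> v /negbTE ->; rewrite marginalT.
by rewrite muleC; congr (_ * _)%E; [apply: eq_bigr => v /negbTE ->|apply: eq_bigr => v ->].
Qed.

(** Almost surely the conditional probability of the masked data is a function of the reset
    parameters, which are independent of the rectangle. *)
Lemma group_data_indep y :
  P ([set w | mask_data (data n m w) == y] `&` params M n @^-1` rectangle A) =
  (P [set w | mask_data (data n m w) == y] * P (params M n @^-1` rectangle A))%E.
Proof.
have mR := measurable_rectangle mA.
have mB : measurable (params M n @^-1` rectangle A) by exact: measurable_params_preimage.
have mphi : measurable_fun setT (reset_params \o params M n).
  by apply: measurableT_comp; [exact: measurable_reset|exact: measurable_params].
pose H (p : n.-tuple R) : \bar R := (mask_law y p)%:E.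
have H0 p : (0 <= H p)%E by rewrite lee_fin sumr_ge0 // => x _; exact: data_mass_ge0.
have mH : measurable_fun setT H by apply/measurable_EFinP; exact: measurable_mask_law.
have reset (B : set (n.-tuple R)) : measurable B ->
    P ([set w | mask_data (data n m w) == y] `&` params M n @^-1` B) =
    (\int[P]_(w in params M n @^-1` B) H ((reset_params \o params M n) w))%E.
  move=> mB'; rewrite (prob_data_pred M (fun x => mask_data x == y)) //.
  apply: ge0_ae_eq_integral.
  - exact: measurable_params_preimage.
  - apply: measurable_funTS; apply: measurableT_comp mH _; exact: measurable_params.
  - by apply: measurable_funTS; apply: measurableT_comp mH _.
  - by move=> w _; exact: H0.
  - by move=> w _; exact: H0.
  apply: filterS (regular_ae M n) => w [cw _] _.
  by rewrite /H /= -mask_law_reset.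
have := reset setT measurableT; rewrite preimage_setT setIT => ->.
rewrite reset // muleC.
exact: (integral_indep mB mphi mH H0 reset_indep).
Qed.
End GroupIndep.


(** * Measurability of the adversary's tests *)

Section BoolMeasurability.
Context d (T : measurableType d).

Lemma measurable_const_bool (c : bool) : measurable [set _ : T | c].
Proof.
case: c; first by rewrite (_ : [set _ | _] = setT) //; apply/seteqP; split.
by rewrite (_ : [set _ | _] = set0) //; apply/seteqP; split.
Qed.

Lemma measurable_andb (b c : T -> bool) : measurable [set p | b p] ->
  measurable [set p | c p] -> measurable [set p | b p && c p].
Proof.
move=> mb mc; rewrite (_ : [set _ | _] = [set p | b p] `&` [set p | c p]).
  exact: measurableI.
by apply/seteqP; split=> p /= => [/andP|[-> ->]].
Qed.

Lemma measurable_implyb (c : bool) (b : T -> bool) : measurable [set p | b p] ->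
  measurable [set p | c ==> b p].
Proof. by case: c => // _; exact: measurable_const_bool. Qed.

Lemma measurable_forallb (I : finType) (b : I -> T -> bool) :
  (forall i, measurable [set p | b i p]) -> measurable [set p | [forall i, b i p]].
Proof.
move=> mb; rewrite (_ : [set _ | _] = [set p | forall i, [set p | b i p] p]).
  exact: measurable_forall.
by apply/seteqP; split=> p /= /forallP.
Qed.

Lemma measurable_existsb (I : finType) (b : I -> T -> bool) :
  (forall i, measurable [set p | b i p]) -> measurable [set p | [exists i, b i p]].
Proof.
move=> mb; rewrite (_ : [set _ | _] = [set p | exists i, [set p | b i p] p]).
  exact: measurable_exists.
by apply/seteqP; split=> p /= /existsP.
Qed.
End BoolMeasurability.

Section MatchMeasurability.
Variables (R : realType) (m n : nat).
Implicit Types (X : 'M[bool]_(m, n)) (g : rel 'I_n).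

Lemma measurable_close (c eta : R) (a : 'I_n) :
  measurable [set p : n.-tuple R | `|c - tnth p a| <= eta].
Proof.
apply: (measurable_norm_le (h := fun p : n.-tuple R => c - tnth p a)).
by apply: measurable_funB => //; exact: measurable_tnth.
Qed.

Lemma measurable_matches eta g u0 X phi :
  measurable [set p : n.-tuple R | matches eta g u0 p X phi].
Proof.
apply: measurable_forallb => a; apply: measurable_implyb; apply: measurable_andb.
  exact: measurable_close.
exact: measurable_const_bool.
Qed.

Lemma measurable_impostor eta g u0 X u phi :
  measurable [set p : n.-tuple R | impostor eta g u0 p X u phi].
Proof.
apply: measurable_andb; first exact: measurable_const_bool.
apply: measurable_forallb => a; apply: measurable_implyb.
apply: measurable_andb; first exact: measurable_const_bool.
apply: measurable_andb; first exact: measurable_close.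
exact: measurable_const_bool.
Qed.
End MatchMeasurability.

(** * The probability of an impostor *)

Section Impostor.
Variables (R : realType) (M : population R) (n m : nat).
Local Notation P := (prob M).
Let g : rel 'I_n := fun v w => assoc M v w.

Lemma freq_mask u (x : {ffun 'I_m -> n.-tuple bool}) v w :
  connect g u v -> connect g u w ->
  freq R (data_matrix (mask_data M u x)) v w = freq R (data_matrix x) v w.
Proof.
move=> cv cw; congr (_ / _); apply: eq_bigr => k _.
by rewrite !mxE ffunE !tnth_mktuple !inE cv cw.
Qed.

(** The test reads only traces of the group of [u], which masking preserves. *)
Lemma impostor_mask eta u0 (p : n.-tuple R) u (x : {ffun 'I_m -> n.-tuple bool}) phi :
  impostor eta g u0 p (data_matrix (mask_data M u x)) u phi = impostor eta g u0 p (data_matrix x) u phi.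
Proof.
congr (_ && _); apply: eq_forallb => a; congr (_ ==> _).
have [ca|//] := boolP (connect g u (phi a)); rewrite freq_mask //=; congr (_ && _).
apply: eq_forallb => b.
have [cb|//] := boolP (connect g u (phi b)); rewrite /= /edge !freq_mask //.
Qed.

Variables (eta delta : R) (u0 u : 'I_n) (s : nat).
Hypotheses (eta_ge0 : 0 <= eta) (delta_ge0 : 0 <= delta).
Hypothesis dens : forall p : R, 0 < p < 1 -> density M p <= delta.
Hypotheses (nu : ~~ connect g u0 u) (card_s : #|[set a | connect g u0 a]%SET| = s).

(** The interval of radius [eta] about an empirical mean, given by left end and length as in
    [marginal_interval]. *)
Let box (y : {ffun 'I_m -> n.-tuple bool}) (f : {ffun 'I_n -> 'I_n}) (a : 'I_n) : set R :=
  if connect g u0 a then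
    `[freq R (data_matrix y) (f a) (f a) - eta, (freq R (data_matrix y) (f a) (f a) - eta) + 2 * eta]%classic
  else setT.

Let measurable_box y f a : measurable (box y f a).
Proof. by rewrite /box; case: ifP => // _; exact: measurable_itv. Qed.

(** The [s] parameters are independent, and each falls into its interval of length [2 * eta] with
    probability at most [delta * (2 * eta)]. *)
Lemma prob_box y f :
  (P (params M n @^-1` rectangle (box y f)) <= ((delta * (2 * eta)) ^+ s)%:E)%E.
Proof.
rewrite prob_params //.
have fin a : marginal M (box y f a) = (fine (marginal M (box y f a)))%:E.
  by rewrite fineK // fin_num_measure //; exact: measurable_param.
under eq_bigr do rewrite fin; rewrite prodEFin lee_fin -card_s.
rewrite -prodr_const (big_mkcond (mem [set a | connect g u0 a]%SET)) /=.
apply: ler_prod => a _; rewrite fine_ge0 //=.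
rewrite inE -lee_fin -fin /box; case: ifP => _; last by rewrite marginalT.
by apply: marginal_interval => //; rewrite mulr_ge0.
Qed.

(** The possible restrictions of an impostor to the group of [u0], extended by the default value [u]
    so that each is counted once. They are determined by [y], whatever the parameters. *)
Let cand (y : {ffun 'I_m -> n.-tuple bool}) : pred {ffun 'I_n -> 'I_n} :=
  [pred f | (#|component eta g (data_matrix y) u| == s) &&
    (f \in pffun_on u [set a | connect g u0 a]%SET (component eta g (data_matrix y) u))].

Lemma card_cand y : (#|cand y| <= s ^ s)%N.
Proof.
have [cs|ncs] := eqVneq #|component eta g (data_matrix y) u| s; last first.
  by rewrite eq_card0 // => f; rewrite unfold_in /= (negbTE ncs).
have sub : cand y \subset
    pffun_on u [set a | connect g u0 a]%SET (component eta g (data_matrix y) u).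
  by apply/fintype.subsetP => f /andP[].
by apply: leq_trans (subset_leq_card sub) _; rewrite card_pffun_on cs card_s.
Qed.

Lemma impostor_box y p phi : impostor eta g u0 p (data_matrix y) u phi ->
  exists2 f, cand y f & rectangle (box y f) p.
Proof.
move=> h; have im := impostor_image h.
pose f := [ffun a => if connect g u0 a then phi a else u].
exists f; last first.
  move=> a; rewrite /box; case: ifP => // ca.
  move: h => /andP[_ /forallP/(_ a)]; rewrite ca /= => /and3P[_ h _].
  by move: h; rewrite ffunE ca /= in_itv /= ler_norml => /andP[h1 h2]; apply/andP; split; lra.
apply/andP; split.
  by rewrite -im card_imset ?card_s //; exact: perm_inj.
apply/pffun_onP; split.
  by apply/fintype.subsetP => a; rewrite !inE ffunE; case: ifP => //; rewrite eqxx.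
move=> x /fintype.imageP[a]; rewrite inE => ca ->.
by rewrite ffunE ca -im; apply: imset_f; rewrite inE.
Qed.

Lemma measurable_mask_event y :
  measurable [set w : Defs.space M | mask_data M u (data n m w) == y].
Proof.
apply: (measurable_data_params M (A := fun x => [set _ | mask_data M u x == y])) => x.
exact: measurable_const_bool.
Qed.

(** Each value [y] of the masked data leaves at most [s ^ s] candidates. The box of each one
    constrains only parameters outside the group of [u], so it is independent of the event that the
    masked data are [y]. *)
Lemma prob_impostor :
  (P [set w | exists phi, impostor eta g u0 (params M n w) (data_matrix (data n m w)) u phi] <=
   ((s ^ s)%:R * (delta * (2 * eta)) ^+ s)%:E)%E.
Proof.
set K := (delta * (2 * eta)) ^+ s.
have K0 : 0 <= K by rewrite exprn_ge0 // !mulr_ge0.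
pose z (w : Defs.space M) := mask_data M u (data n m w).
pose A (y : {ffun 'I_m -> n.-tuple bool}) := [set w | exists phi, impostor eta g u0 (params M n w) (data_matrix y) u phi].
have mz y : measurable [set w | z w = y].
  rewrite (_ : [set _ | _] = [set w : Defs.space M | mask_data M u (data n m w) == y]).
    exact: measurable_mask_event.
  by apply/seteqP; split=> w /eqP.
have mA y : measurable (A y).
  apply: measurable_exists => phi.
  exact: (measurable_params_preimage M (measurable_impostor eta g u0 (data_matrix y) u phi)).
rewrite (_ : [set w | _] = [set w | A (z w) w]); last first.
  by apply/seteqP; split=> w [phi h]; exists phi; move: h; rewrite impostor_mask.
rewrite (@measure_fin_partition _ _ _ P _ z A); last by move=> y; exact: measurableI.
have zfin y : P [set w | z w = y] = (fine (P [set w | z w = y]))%:E.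
  by rewrite fineK // fin_num_measure.
have z1 : \sum_y fine (P [set w | z w = y]) = 1.
  apply: EFin_inj; rewrite -sumEFin; under eq_bigr do rewrite -zfin.
  transitivity (P [set w : Defs.space M | [set: Defs.space M] w]); last exact: probability_setT.
  rewrite (@measure_fin_partition _ _ _ P _ z (fun=> setT)); last by move=> y; rewrite setIT.
  by apply: eq_bigr => y _; rewrite setIT.
(* The bound is shared among the values of the masked data in proportion to their probabilities. *)
have -> : (s ^ s)%:R * K = \sum_y fine (P [set w | z w = y]) * ((s ^ s)%:R * K).
  by rewrite -mulr_suml z1 mul1r.
rewrite -sumEFin; apply: lee_sum => y _.
pose F (f : {ffun 'I_n -> 'I_n}) : set (Defs.space M) :=
  if cand y f then [set w | z w = y] `&` params M n @^-1` rectangle (box y f) else set0.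
have mF f : measurable (F f).
  rewrite /F; case: ifP => // _; apply: measurableI => //.
  by apply: measurable_params_preimage; exact: measurable_rectangle.
apply: (@le_trans _ _ (P [set w | exists f, F f w])).
  apply: le_measure; rewrite ?inE; [exact: measurableI|exact: measurable_exists|].
  move=> w [zw [phi /impostor_box[f cf bf]]]; exists f.
  by rewrite /F cf.
apply: le_trans (measure_exists_le P mF) _.
apply: (@le_trans _ _ (\sum_(f | cand y f) (fine (P [set w | z w = y]) * K)%:E)%E).
  rewrite [leRHS]big_mkcond; apply: lee_sum => f _; rewrite /F.
  case: ifP => _; last by rewrite measure0.
  rewrite (_ : [set w | z w = y] = [set w : Defs.space M | mask_data M u (data n m w) == y]); last first.
    by apply/seteqP; split=> w /eqP.
  (* The groups of [u0] and [u] are disjoint, so the box leaves the latter free. *)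
  have out v : v \in Defs.group (assoc M) u -> box y f v = setT.
    rewrite inE => uv; rewrite /box ifN //; apply: contra nu => u0v.
    apply: connect_trans u0v _; rewrite (@sym_connect_sym _ g) // => a b.
    exact: assoc_symmetric.
  rewrite [X in (X <= _)%E](group_data_indep (measurable_box y f) out y).
  rewrite EFinM; apply: lee_pmul; rewrite ?measure_ge0 //.
    by rewrite fineK // fin_num_measure //; exact: measurable_mask_event.
  exact: prob_box.
rewrite sumEFin sumr_const lee_fin -[leLHS]mulr_natl [leLHS]mulrCA.
rewrite ler_wpM2l ?fine_ge0 // ler_wpM2r // ler_nat; exact: card_cand.
Qed.

End Impostor.


(** * Elementary limits, covariance errors, and stability of a group *)

Lemma cvg_add0 (R : realType) (f g : nat -> R) :
  f n @[n --> \oo] --> (0 : R) -> g n @[n --> \oo] --> (0 : R) ->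
  f n + g n @[n --> \oo] --> (0 : R).
Proof. by move=> f0 g0; have h := cvgD f0 g0; rewrite addr0 in h; exact: (h _). Qed.

Lemma cvg_sum0 (R : realType) (I : finType) (f : I -> nat -> R) :
  (forall i, f i n @[n --> \oo] --> (0 : R)) ->
  (\sum_i f i n) @[n --> \oo] --> (0 : R).
Proof.
move=> cf; elim: (index_enum I) => [|i r IH].
  by under eq_fun do rewrite big_nil; exact: cvg_cst.
under eq_fun do rewrite big_cons.
exact: cvg_add0 (cf i) IH.
Qed.

(** [b * c - r * t = (b - r) * c + r * (c - t)], and each of these two terms is at most [e] in
    absolute value. *)
Lemma covariance_close (R : realType) (a b c q r t e : R) :
  `|a - q| <= e -> `|b - r| <= e -> `|c - t| <= e -> 0 <= c <= 1 -> 0 <= r <= 1 ->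
  `|(a - b * c) - (q - r * t)| <= 3 * e.
Proof.
move=> h1 h2 h3 /andP[c0 c1] /andP[r0 r1].
have -> : (a - b * c) - (q - r * t) = (a - q) - ((b - r) * c + r * (c - t)) by ring.
have hc : `|(b - r) * c| <= e.
  by rewrite normrM (ger0_norm c0) (le_trans _ h2) // ler_piMr.
have hr : `|r * (c - t)| <= e.
  by rewrite normrM (ger0_norm r0) (le_trans _ h3) // ler_piMl.
move: h1 hc hr; rewrite !ler_norml => /andP[? ?] /andP[? ?] /andP[? ?].
by apply/andP; split; lra.
Qed.

Lemma freq01 (R : realType) m n (X : 'M[bool]_(m, n)) v w : 0 <= freq R X v w <= 1.
Proof.
rewrite divr_ge0 ?sumr_ge0 //=.
have h : \sum_(k < m) (X k v && X k w)%:R <= m%:R :> R.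
  rewrite -[leRHS]mulr1 mulr_natl -[X in _ *+ X](card_ord m) -sumr_const.
  by apply: ler_sum => k _; case: (_ && _); rewrite ?ler01.
(* Without observations [freq] is a division by zero, hence 0. *)
case: m X h => [|m] X h; first by rewrite /freq invr0 mulr0 ler01.
by rewrite /freq ler_pdivrMr ?mul1r // ltr0n.
Qed.

(** The group in the smaller system embeds into that of the larger one, and equal cardinalities make
    the embedding onto. *)
Lemma group_stable (E : rel nat) (n n' : nat) (u : 'I_n) (u' : 'I_n') :
  (n <= n')%N -> u = u' :> nat -> #|Defs.group E u| = #|Defs.group E u'| ->
  forall v, v \in Defs.group E u' -> (v < n)%N.
Proof.
move=> nn uu card_eq v.
pose h := widen_ord nn.
have hinj : injective h by move=> x y /(congr1 val) /= xy; apply: val_inj.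
have u'E : u' = h u by apply: val_inj; rewrite /= uu.
have sub : h @: Defs.group E u \subset Defs.group E u'.
  apply/fintype.subsetP => _ /imsetP[w + ->]; rewrite !inE => /connectP[q + ->].
  rewrite u'E; elim: q (u) => [|x q IH] y /=; first by rewrite connect0.
  by move=> /andP[yx /IH]; apply: connect_trans; apply: connect1.
have /eqP <- : h @: Defs.group E u == Defs.group E u'.
  by rewrite eqEcard sub card_imset //= card_eq leqnn.
by move=> /imsetP[w _ ->] /=.
Qed.

(** * The adversary *)

Section Algorithm.
Variables (R : realType) (s : nat) (alpha : R).

(** The first two quantifiers locate user 0 and time [k]; the answer is [false] if either is out of
    range. The third accepts any match that reads 1, which avoids choosing one. *)
Definition matching_algorithm : algorithm R := fun n m p g Y k =>
  [exists u0 : 'I_n, (u0 == 0 :> nat) && [exists i : 'I_m, (i == k :> nat) &&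
    [exists phi : 'S_n, matches (tolerance s alpha n) g u0 p Y phi && Y i (phi u0)]]].

Lemma measurable_matching_algorithm : measurable_algorithm matching_algorithm.
Proof.
move=> n m g Y k; apply: measurable_existsb => u0.
apply: measurable_andb; first exact: measurable_const_bool.
apply: measurable_existsb => i; apply: measurable_andb; first exact: measurable_const_bool.
apply: measurable_existsb => phi; apply: measurable_andb; first exact: measurable_matches.
exact: measurable_const_bool.
Qed.

Lemma matching_algorithmE n m (p : n.-tuple R) g (X : 'M[bool]_(m, n)) (pi : 'S_n)
    (u0 : 'I_n) (i : 'I_m) : u0 = 0 :> nat ->
  matches (tolerance s alpha n) g u0 p X 1 ->
  (forall phi, matches (tolerance s alpha n) g u0 p X phi -> phi u0 = u0) ->
  matching_algorithm p g (\matrix_(k, v) X k ((pi^-1)%g v)) i = X i u0.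
Proof.
move=> u00 m1 mu.
apply/existsP/idP => [[u1 /andP[/eqP u10 /existsP[j /andP[/eqP ji /existsP[phi /andP[+ +]]]]]]|Xi].
  have -> : u1 = u0 by apply: val_inj; rewrite /= u10 u00.
  have -> : j = i by exact: val_inj.
  by rewrite matches_perm mxE => /mu; rewrite permM => ->.
exists u0; rewrite u00 eqxx /=; apply/existsP; exists i; rewrite eqxx /=.
(* On the unpermuted data, the true permutation [pi] becomes the identity. *)
apply/existsP; exists pi; rewrite matches_perm mulgV m1 /= mxE.
by rewrite permK.
Qed.
End Algorithm.

Section Main.
Variables (R : realType) (M : population R).
Local Notation P := (prob M).

(** Apart from the parameters, the event depends on finitely many values: the permutation, the data
    and the target bit. *)
Lemma estimate_measurable (alg : algorithm R) n k : measurable_algorithm alg ->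
  measurable [set w | estimate alg n k w <> sample M 0 k w].
Proof.
move=> malg; pose m := observations M n.
pose F (sx : 'S_n * {ffun 'I_m -> n.-tuple bool} * bool) : set (Defs.space M) :=
  [set w | anonymization M n w = sx.1.1] `&` [set w | data n m w = sx.1.2] `&`
  (params M n @^-1` [set p | alg n m p (fun u v : 'I_n => assoc M u v)
     (\matrix_(k, v) data_matrix sx.1.2 k ((sx.1.1)^-1%g v)) k != sx.2]) `&`
  (sample M 0 k @^-1` [set sx.2]).
rewrite (_ : [set w | _] = [set w | exists sx, F sx w]).
  apply: measurable_exists => sx; apply: measurableI; last first.
    by rewrite -[X in measurable X]setTI; exact: measurable_funP.
  apply: measurableI.
    apply: measurableI; [exact: anonymization_measurable|exact: measurable_data].
  apply: measurable_params_preimage.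
  set Y := \matrix_(_, _) _.
  have mA := malg n m (fun u v : 'I_n => assoc M u v) Y k.
  case: (sx.2).
    rewrite (_ : [set p | _] = ~` [set p | alg n m p (fun u v : 'I_n => assoc M u v) Y k]).
      exact: measurableC.
    by apply/seteqP; split=> p /=; case: (alg _ _ _ _ _ _).
  rewrite (_ : [set p | _] = [set p | alg n m p (fun u v : 'I_n => assoc M u v) Y k]) //.
  by apply/seteqP; split=> p /=; case: (alg _ _ _ _ _ _).
have YE w : anonymized n w = \matrix_(k, v) data_matrix (data n m w) k ((anonymization M n w)^-1%g v).
  by apply/matrixP => i v; rewrite !mxE ffunE tnth_mktuple.
apply/seteqP; split=> w /=.
  rewrite /estimate YE => /eqP ne.
  by exists (anonymization M n w, data n m w, sample M 0 k w).
by move=> [sx [[[/= sE xE] /eqP aE] kE]]; rewrite /estimate YE sE xE kE.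
Qed.

End Main.


(** * Correctness of the estimate outside the bad events *)

Section Correct.
Variables (R : realType) (M : population R) (s : nat) (alpha : R).
Variables (n0 n : nat) (u0 : 'I_n) (w : Defs.space M).
Local Notation m := (observations M n).
Local Notation eta := (tolerance s alpha n).
Let g : rel 'I_n := fun u v => assoc M u v.
Hypotheses (u00 : u0 = 0 :> nat) (stable : forall v, connect g u0 v -> (v < n0)%N).
Hypotheses (reg : regular M (params M n w)) (reg0 : regular M (params M n0 w)).
Hypothesis conc : ~ deviates M eta (data n m w) (params M n w).
Hypothesis conc0 : ~ deviates M eta (data n0 m w) (params M n0 w).
Hypothesis gap : forall u v : 'I_n0, u != v -> 2 * eta < `|param M u w - param M v w|.
Hypothesis strong : forall u v : 'I_n0, u != v -> assoc M u v ->
  6 * eta < `|pair_law M (params M n0 w) u v -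
              pair_law M (params M n0 w) u u * pair_law M (params M n0 w) v v|.
Hypothesis genuine : forall u phi, ~~ connect g u0 u ->
  ~~ impostor eta g u0 (params M n w) (data_matrix (data n m w)) u phi.

Lemma not_deviates n1 (x : {ffun 'I_m -> n1.-tuple bool}) p :
  ~ deviates M eta x p -> forall u v, `|freq R (data_matrix x) u v - pair_law M p u v| <= eta.
Proof.
by move=> h u v; rewrite leNgt; apply/negP => d; apply: h; exists (u, v).
Qed.

(** The conditions of [matches_unique] are checked at a fixed outcome: false edges are excluded in
    the system of [n] users, while true edges and gaps are read in the fixed system of [n0]
    users. *)
Lemma estimate_correct k : (k < m)%N ->
  estimate (matching_algorithm s alpha) n k w = sample M 0 k w.
Proof.
move=> km; set X := data_matrix (data n m w); set p := params M n w.
have XE (i : 'I_m) v : X i v = sample M v i w by rewrite mxE ffunE tnth_mktuple.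
have clos := not_deviates conc.
have clos0 := not_deviates conc0.
have girr : irreflexive g by move=> v; exact: assoc_irreflexive.
have [cube rel] := reg; have [_ rel0] := reg0.
have close_cov u v : `|(freq R X u v - freq R X u u * freq R X v v) -
    (pair_law M p u v - pair_law M p u u * pair_law M p v v)| <= 3 * eta.
  by apply: covariance_close => //; [exact: freq01|exact: pair_law01].
have [m1 mu] : matches eta g u0 p X 1 /\
    forall phi, matches eta g u0 p X phi -> phi u0 = u0.
  apply: matches_unique => //.
  (* The covariance of an unassociated pair is 0, so its estimate stays within [3 * eta]. *)
  - move=> u v /andP[uv]; apply: contraTT => nuv.
    have := rel u v uv; rewrite -/(g u v) (negbTE nuv) => /esym/negbFE/eqP q0.
    by rewrite -leNgt; have := close_cov u v; rewrite q0 subrr subr0.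
  - move=> u v cu guv.
    have uv : u != v by apply: contraTneq guv => ->; rewrite girr.
    have cv : connect g u0 v by apply: connect_trans cu (connect1 guv).
    pose u' := Ordinal (stable cu); pose v' := Ordinal (stable cv).
    have uv' : u' != v' by [].
    rewrite /edge uv /=.
    pose X0 := data_matrix (data n0 m w); pose p0 := params M n0 w.
    (* Both systems contain the same samples of the first [n0] users, at the same times. *)
    have fE (a b : 'I_n) (a' b' : 'I_n0) : a = a' :> nat -> b = b' :> nat ->
        freq R X a b = freq R X0 a' b'.
      move=> aa bb; congr (_ / _); apply: eq_bigr => i _.
      by rewrite !mxE !ffunE !tnth_mktuple aa bb.
    rewrite (fE u v u' v') // (fE u u u' u') // (fE v v v' v') //.
    (* A strength above [6 * eta], less an error of at most [3 * eta], exceeds the threshold of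
       [edge]. *)
    have hs := strong uv' guv.
    have hc : `|(freq R X0 u' v' - freq R X0 u' u' * freq R X0 v' v') -
        (pair_law M p0 u' v' - pair_law M p0 u' u' * pair_law M p0 v' v')| <= 3 * eta.
      by apply: covariance_close => //; [exact: freq01|exact: pair_law01].
    move: hs hc; rewrite -/p0; set a := _ - _; set b := _ - _ * freq _ _ _ _.
    move=> hs hc; have := ler_normD b (a - b).
    by rewrite addrC subrK [`|a - b|]distrC; lra.
  - by move=> v _; rewrite -(pair_law_diag M v cube).
  - move=> v cv vn.
    have hu : (u0 < n0)%N by apply: stable; exact: connect0.
    have := @gap (Ordinal (stable cv)) (Ordinal hu) vn.
    by rewrite /p !tnth_mktuple.
have := matching_algorithmE (anonymization M n w) (Ordinal km) u00 m1 mu.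
rewrite XE u00 /= => <-; rewrite /estimate; congr (matching_algorithm _ _ _ _ _ _).
by apply/matrixP => i v; rewrite !mxE ffunE tnth_mktuple.
Qed.
End Correct.

(* The last condition says that m(n) is the real number c n^(2/s + alpha)
   rounded, up or down, to an integer. *)
Theorem theorem1 (R : realType) (s : nat) (c alpha : R)
    (c_gt0 : 0 < c) (alpha_gt0 : 0 < alpha) :
  no_privacy (fun M : population R => group_size M 0 s /\
    forall n : nat, `|(observations M n)%:R - c * n%:R `^ (2 / s%:R + alpha)| < 1) 0.
Proof.
exists (matching_algorithm s alpha); first exact: measurable_matching_algorithm.
move=> M [[N _ sized] rate] k; set P := prob M; pose m n := observations M n.
(* From n0 on the group of user 0 stays within the first n0 users; the strength of its
   edges and the gaps between its parameters are those of the system of n0 users,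
   whose law is fixed. *)
pose n0 := N.+1.
have size_at n (u : 'I_n) : (n0 <= n)%N -> u = 0 :> nat -> #|Defs.group (assoc M) u| = s.
  by move=> n0n u0; apply: sized => //; exact: ltnW.
have s_gt0 : (0 < s)%N.
  rewrite -(size_at n0 ord0) //; apply/card_gt0P; exists ord0.
  by rewrite inE connect0.
have [d1 [delta [d10 delta0 dens']]] := density_bounds M.
have dens q : 0 < q < 1 -> density M q <= delta by move=> /dens'/andP[].
pose tol := tolerance s alpha.
pose b n : R := 2 * n%:R ^+ 2 * expR (- ((m n)%:R * tol n ^+ 2 / 8)).
(* In [hG] and [hW], pairs under no constraint get the value 1, never 0, so that [small_ball_cvg]
   applies to all pairs alike. *)
pose hG (uv : 'I_n0 * 'I_n0) (w : Defs.space M) : R :=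
  if uv.1 != uv.2 then param M uv.1 w - param M uv.2 w else 1.
pose cov (uv : 'I_n0 * 'I_n0) (w : Defs.space M) : R :=
  pair_law M (params M n0 w) uv.1 uv.2 -
  pair_law M (params M n0 w) uv.1 uv.1 * pair_law M (params M n0 w) uv.2 uv.2.
pose hW (uv : 'I_n0 * 'I_n0) (w : Defs.space M) : R :=
  if (uv.1 != uv.2) && assoc M uv.1 uv.2 then cov uv w else 1.
have mG uv : measurable_fun setT (hG uv).
  by rewrite /hG; case: (_ != _) => //; exact: measurable_funB.
have mcov uv : measurable_fun setT (cov uv).
  have mq u v : measurable_fun setT (fun w => pair_law M (params M n0 w) u v).
    apply: (@measurableT_comp _ _ _ _ _ _ (fun p => pair_law M p u v)).
      exact: measurable_pair_law.
    exact: measurable_params.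
  by apply: measurable_funB => //; exact: measurable_funM.
have mW uv : measurable_fun setT (hW uv).
  by rewrite /hW; case: (_ && _).
have G0 uv : P [set w | hG uv w = 0] = 0%E.
  rewrite /hG; have [e|ne] := eqVneq uv.1 uv.2 => /=.
    rewrite (_ : [set w | _] = set0) ?measure0 //.
    by apply/seteqP; split=> w //= /eqP; rewrite oner_eq0.
  rewrite -(@prob_param_eq R M uv.1 uv.2) //; congr (P _).
  by apply/seteqP; split=> w /= => [/eqP|->]; rewrite ?subrr // subr_eq0 => /eqP.
have W0 uv : P [set w | hW uv w = 0] = 0%E.
  have mW0 : measurable [set w | hW uv w = 0].
    rewrite (_ : [set w | _] = hW uv @^-1` [set 0]) //.
    by rewrite -[X in measurable X]setTI; exact: mW.
  apply/measure_negligible => //.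
  (* Off a null set an associated pair has nonzero covariance. *)
  have [Z [mZ PZ subZ]] := regular_ae M n0; exists Z; split => // w /= h0.
  apply: subZ => /= -[_ rel]; move: h0; rewrite /hW.
  case: ifPn => [/andP[ne a]|_ /eqP]; last by rewrite oner_eq0.
  by have := rel uv.1 uv.2 ne; rewrite a /cov -subr_eq0 => /esym/eqP h /h.
pose gG uv n : R := fine (P [set w | `|hG uv w| <= 2 * tol n]).
pose gW uv n : R := fine (P [set w | `|hW uv w| <= 6 * tol n]).
pose K : R := (s ^ s)%:R * (delta * 2) ^+ s.
(* The terms bound, in this order, the probabilities of [D], [D0], [G], [W] and [II] below. *)
pose r n : R := b n + b n + \sum_uv gG uv n + \sum_uv gW uv n + n%:R * (K * tol n ^+ s).
have tol0 : tol n @[n --> \oo] --> 0 by exact: tolerance_cvg.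
have ctol (a : R) : a * tol n @[n --> \oo] --> 0.
  by have h := cvgMl_tmp (a := a) tol0; rewrite mulr0 in h; exact: (h _).
have b0 : b n @[n --> \oo] --> 0 by exact: (union_bound_cvg s_gt0 c_gt0 alpha_gt0 rate).
have sG : \sum_uv gG uv n @[n --> \oo] --> 0.
  apply: cvg_sum0 => uv; exact: small_ball_cvg (mG uv) (G0 uv) (ctol 2).
have sW : \sum_uv gW uv n @[n --> \oo] --> 0.
  apply: cvg_sum0 => uv; exact: small_ball_cvg (mW uv) (W0 uv) (ctol 6).
have r0 : r n @[n --> \oo] --> 0.
  apply: cvg_add0 (tolerance_expn_cvg s_gt0 alpha_gt0 K).
  exact: cvg_add0 (cvg_add0 (cvg_add0 b0 b0) sG) sW.
have bound : \forall n \near \oo,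
    (P [set w | estimate (matching_algorithm s alpha) n k w <> sample M 0 k w] <= (r n)%:E)%E.
  near=> n.
  have n0n : (n0 <= n)%N by near: n; exact: nbhs_infty_ge.
  have km : (k < m n)%N.
    by near: n; exact: (observations_unbounded s_gt0 c_gt0 alpha_gt0 rate).
  have n_gt0 : (0 < n)%N by exact: leq_trans n0n.
  have m_gt0 : (0 < m n)%N by exact: leq_ltn_trans km.
  have tol01 : 0 <= tol n <= 1 by rewrite tolerance_ge0 tolerance_le1.
  pose u0 : 'I_n := Ordinal n_gt0.
  pose g : rel 'I_n := fun u v => assoc M u v.
  have [Z [mZ PZ subZ]] := regular_ae M n.
  have [Z0 [mZ0 PZ0 subZ0]] := regular_ae M n0.
  pose D := [set w | deviates M (tol n) (data n (m n) w) (params M n w)].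
  pose D0 := [set w | deviates M (tol n) (data n0 (m n) w) (params M n0 w)].
  pose G := [set w | exists uv, [set w | `|hG uv w| <= 2 * tol n] w].
  pose W := [set w | exists uv, [set w | `|hW uv w| <= 6 * tol n] w].
  (* Within the group of user 0 confusions are excluded by the gaps, through [G]. *)
  pose I u := if connect g u0 u then set0 else
    [set w | exists phi, impostor (tol n) g u0 (params M n w) (data_matrix (data n (m n) w)) u phi].
  have mD : measurable D.
    exact: (measurable_data_params M (fun x => measurable_deviates M (tol n) x)).
  have mD0 : measurable D0.
    exact: (measurable_data_params M (fun x => measurable_deviates M (tol n) x)).
  have mG' uv : measurable [set w | `|hG uv w| <= 2 * tol n] by exact: measurable_norm_le.
  have mW' uv : measurable [set w | `|hW uv w| <= 6 * tol n] by exact: measurable_norm_le.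
  have mI u : measurable (I u).
    rewrite /I; case: ifP => // _; apply: measurable_exists => phi.
    apply: (measurable_data_params M (A := fun x => [set p | impostor (tol n) g u0 p (data_matrix x) u phi])) => x.
    exact: measurable_impostor.
  pose II := [set w | exists u, I u w].
  have mGG : measurable G by exact: measurable_exists.
  have mWW : measurable W by exact: measurable_exists.
  have mII : measurable II by exact: measurable_exists.
  pose Bad := D `|` D0 `|` G `|` W `|` II `|` (Z `|` Z0).
  have mZZ : measurable (Z `|` Z0) by exact: measurableU.
  have PZZ : P (Z `|` Z0) = 0%E by rewrite measureU0.
  have mDD : measurable (D `|` D0) by exact: measurableU.
  have mDG : measurable (D `|` D0 `|` G) by exact: measurableU.
  have mDW : measurable (D `|` D0 `|` G `|` W) by exact: measurableU.
  have mDI : measurable (D `|` D0 `|` G `|` W `|` II) by exact: measurableU.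
  apply: (@le_trans _ _ (P Bad)).
    apply: le_measure; rewrite ?inE; [|exact: measurableU|].
      by apply: estimate_measurable; exact: measurable_matching_algorithm.
    move=> w /= err; apply: contrapT => good; apply: err.
    move: good; rewrite /Bad /= => /not_orP[/not_orP[/not_orP[/not_orP[/not_orP[nD nD0] nG] nW] nI] /not_orP[nZ nZ0]].
    apply: (@estimate_correct R M s alpha n0 n u0) => //.
    - move=> v cv; apply: (@group_stable (assoc M) n0 n ord0 u0) => //.
        by rewrite !size_at.
      by rewrite inE.
    - by apply: contrapT => h; apply: nZ; exact: subZ.
    - by apply: contrapT => h; apply: nZ0; exact: subZ0.
    - move=> u v uv; rewrite ltNge; apply/negP => h; apply: nG; exists (u, v).
      by rewrite /= /hG /= uv.
    - move=> u v uv a; rewrite ltNge; apply/negP => h; apply: nW; exists (u, v).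
      by rewrite /= /hW /= uv a.
    - move=> u phi nc; apply/negP => h; apply: nI; exists u.
      by rewrite /I (negbTE nc); exists phi.
  rewrite /Bad measureU0 //.
  have PD : (P D <= (b n)%:E)%E by exact: prob_deviates.
  have PD0 : (P D0 <= (b n)%:E)%E.
    (* The system of [n0] users has at most as many pairs as that of [n], so the same bound
       serves. *)
    apply: le_trans (prob_deviates M n0 m_gt0 tol01) _.
    rewrite lee_fin ler_wpM2r ?expR_ge0 // ler_wpM2l //.
    by rewrite lerXn2r ?nnegrE // ler_nat.
  have PG : (P G <= (\sum_uv gG uv n)%:E)%E.
    apply: le_trans (measure_exists_le P mG') _.
    rewrite -sumEFin; apply: lee_sum => uv _.
    by rewrite /gG fineK // fin_num_measure.
  have PW : (P W <= (\sum_uv gW uv n)%:E)%E.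
    apply: le_trans (measure_exists_le P mW') _.
    rewrite -sumEFin; apply: lee_sum => uv _.
    by rewrite /gW fineK // fin_num_measure.
  have PI : (P II <= (n%:R * (K * tol n ^+ s))%:E)%E.
    apply: le_trans (measure_exists_le P mI) _.
    have -> : n%:R * (K * tol n ^+ s) = \sum_(u < n) (K * tol n ^+ s).
      by rewrite sumr_const card_ord mulr_natl.
    have K0 : 0 <= K * tol n ^+ s.
      by rewrite /K !mulr_ge0 ?exprn_ge0 ?tolerance_ge0 // mulr_ge0 // ltW.
    rewrite -sumEFin; apply: lee_sum => u _; rewrite /I.
    case: ifPn => [_|nc]; first by rewrite measure0 lee_fin.
    have -> : K * tol n ^+ s = (s ^ s)%:R * (delta * (2 * tol n)) ^+ s.
      by rewrite (mulrA delta) [(delta * 2 * _) ^+ s]exprMn mulrA.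
    apply: prob_impostor => //; [exact: tolerance_ge0|exact: ltW|].
    exact: (size_at n u0).
  rewrite /r !EFinD.
  apply: le_trans (measureU2 P mDW mII) (leeD _ PI).
  apply: le_trans (measureU2 P mDG mWW) (leeD _ PW).
  apply: le_trans (measureU2 P mDD mGG) (leeD _ PG).
  exact: le_trans (measureU2 P mD mD0) (leeD PD PD0).
apply: (@squeeze_cvge _ _ _ _ (fun=> 0%E) _ (fun n => (r n)%:E)).
- by apply: filterS bound => n h; rewrite h measure_ge0.
- exact: cvg_cst.
- by apply: cvg_EFin; [exact: nearW|exact: r0].
Unshelve. all: by end_near. Qed.
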